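(* Let $\lambda>0$, let $N=(N_t)_{t\ge 0}$ be a Poisson process with constant intensity $\lambda$, let $C_t$ be the number of completed record inter-arrival times up to time $t$, and let $W_t$ be the total amount of time up to time $t$ that the Poisson process spends in record lifetimes (precise definitions in the context). Then, with probability 1, $$\lim_{t\to\infty}\frac{C_t}{\log t}=1\qquad\text{and}\qquad \lim_{t\to\infty}\frac{W_t}{(\log t)^2}=\frac{1}{2\lambda}.$$
   Context: Let $(X_k)_{k\in\mathbb{N}}$ be independent random variables on a probability space $(\Omega,\mathcal{A},P)$, each exponentially distributed with parameter $\lambda>0$, i.e. $P(X_k\le x)=1-e^{-\lambda x}$ for $x\ge 0$. Put $S_0=0$, $S_n=\sum_{k=1}^n X_k$ for $n\ge 1$, and $N_t=\sup\{n\in\mathbb{N}_0: S_n\le t\}$ for $t\ge 0$; this is the Poisson process with inter-arrival times $X_k$. Define the record indicators by $I_1=1$ and $I_n=\prod_{k=1}^{n-1}1_{\{X_n>X_k\}}$ for $n\ge 2$. For $t\ge 0$ put $$C_t=\#\{1\le n\le N_t: I_n=1\}$$ (with $C_t=0$ if $N_t=0$), and $$W_t=\int_0^t I_{N_s+1}\,ds=\mathrm{Leb}(\{0\le s\le t: I_{N_s+1}=1\}).$$ *)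

(* Defs.v *)
From HB Require Import structures.
From mathcomp Require Import all_boot all_order all_algebra finmap.
From mathcomp Require Import all_classical all_reals all_analysis.

Set Implicit Arguments.
Unset Strict Implicit.
Unset Printing Implicit Defensive.

Import Order.TTheory GRing.Theory Num.Theory.
Import numFieldNormedType.Exports.

Local Open Scope classical_set_scope.
Local Open Scope ring_scope.

Section poisson_records.
Context d (T : measurableType d) (R : realType) (P : probability T R).

(* Mutual independence: the product rule over every finite subfamily. *)
Definition independent_RVs (I : choiceType) (X : I -> {RV P >-> R}) : Prop :=
  forall (J : {fset I}) (A : I -> set R),
    (forall i, i \in J -> measurable (A i)) ->
    P (\bigcap_(i in [set` J]) (X i @^-1` A i)) =
    (\prod_(i <- J) P (X i @^-1` A i))%E.

(* Since cdf (X k) is nondecreasing, tends to 0 at -oo and vanishes at 0,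
   prescribing it on [0, +oo[ determines the law. *)
Definition exponentially_distributed (lambda : R) (X : {RV P >-> R}) : Prop :=
  forall x : R, 0 <= x -> cdf X x = (1 - expR (- lambda * x))%:E.

(* Sequences are indexed from 0: X k is the (k+1)-st inter-arrival time, so
   record X n is the record indicator I_(n+1). *)
Variable X : nat -> {RV P >-> R}.

Definition arrival (n : nat) (w : T) : R := \sum_(k < n) X k w.

(* Supremum in nat. It is 0 by convention if the set is unbounded, i.e. if
   infinitely many arrivals occur before t (a null event in the theorem). *)
Definition poisson (t : R) (w : T) : nat :=
  supremum 0%N [set n | arrival n w <= t].

Definition record (n : nat) (w : T) : R :=
  \prod_(k < n) \1_[set w' | X k w' < X n w'] w.

Definition completed_records (t : R) (w : T) : nat :=
  #|[pred n : 'I_(poisson t w) | record n w == 1]|.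

(* The interval in progress at time s is the (N_s + 1)-st one, whose indicator
   is record (N_s) in the indexing from 0. *)
Definition record_time (t : R) (w : T) : R :=
  \int[lebesgue_measure]_(s in `[0, t]) record (poisson s w) w.

End poisson_records.

(* Main.v *)
Require Import Defs.
From HB Require Import structures.
From mathcomp Require Import all_boot all_order all_algebra finmap.
From mathcomp Require Import all_classical all_reals all_analysis.
From mathcomp Require Import measurable_realfun.
From mathcomp Require Import ring lra zify.

Set Implicit Arguments.
Unset Strict Implicit.
Unset Printing Implicit Defensive.

Import Order.TTheory GRing.Theory Num.Theory.
Import numFieldNormedType.Exports.

Local Open Scope classical_set_scope.
Local Open Scope ring_scope.

(** Write S n for the n-th arrival time, K n for the number of records among
    the first n inter-arrival times, V n for the sum of the lengths of these
    records, and N for the counting process at time t.  The number of completed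
    records is K N, and the record time lies between V N and V (N + 1), so the
    theorem is a statement about the growth of K, V and S.

    The indicators of records in an i.i.d. sequence with continuous law are
    pairwise independent, the n-th one (from 0) having mean 1 / (n + 1)
    ([prob_record_event], [record_events_pairwise_independent]).  A second
    moment argument gives a strong law for pairwise independent events
    ([strong_law_pairwise_independent_events]), hence K n ~ ln n almost surely.

    The running maximum of the exponential variables is equivalent to
    ln n / lambda ([ae_eventually_exp_le], [ae_eventually_exists_exp_gt]).  A
    record is a new maximum, so a record at time n has length about
    ln n / lambda, that is, about j / lambda if it is the j-th record.  Summing
    over j gives V n ~ (K n)^2 / (2 lambda) ~ (ln n)^2 / (2 lambda)
    ([cvg_record_length_sum]).

    Finally S n lies between c n and a multiple of n ln n, and the logarithm
    does not distinguish these: ln (S n) ~ ln n ([cvg_ln_sum_ratio]).  Since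
    S N <= t < S (N + 1), also ln N ~ ln t ([cvg_ln_poisson]), and n may be
    replaced by N and ln N by ln t in the two equivalences above.

    Independence is given as the product rule, which only concerns boxes,
    whereas a record event compares two variables.  The probabilities of record
    events are therefore obtained by cutting the range of the last variable
    into small intervals and bracketing by boxes ([prob_exceed]); after the
    reduction to uniform variables this computes the integral of a power. *)

(** * Strong law for pairwise independent events *)

Section borel_cantelli.
Context d (T : measurableType d) (R : realType) (P : probability T R).

(** First Borel-Cantelli lemma, in the form in which the estimates come out:
    real bounds on the probabilities, with bounded partial sums. *)
Lemma ae_eventually_notin (A : nat -> set T) (c : nat -> R) (B : R) :
  (forall n, measurable (A n)) ->
  (forall n, (P (A n) <= (c n)%:E)%E) ->
  (forall n, \sum_(0 <= k < n) c k <= B) ->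
  {ae P, forall w, \forall n \near \oo, ~ A n w}.
Proof.
move=> mA Ac cB.
have lim0 : P (lim_sup_set A) = 0%E.
  apply: lim_sup_set_cvg0 => //.
  apply: (@le_lt_trans _ _ B%:E); last exact: ltry.
  apply: lime_le; first exact: is_cvg_nneseries.
  apply: nearW => n; apply: (@le_trans _ _ (\sum_(0 <= k < n) (c k)%:E)%E).
    by apply: lee_sum => k _; exact: Ac.
  by rewrite sumEFin lee_fin.
have mL : measurable (lim_sup_set A).
  by apply: bigcap_measurable => // k _; exact: bigcup_measurable.
exists (lim_sup_set A); split => // w /= nw n _.
apply: contrapT => h; apply: nw; exists n => // k /= nk Akw.
by apply: h; exists k.
Qed.

End borel_cantelli.

Section counting.
Context d (T : measurableType d) (R : realType) (P : probability T R).
Variables (A : nat -> set T) (p : nat -> R).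

Definition count_events (n : nat) (w : T) : R := \sum_(0 <= k < n) \1_(A k) w.

Hypothesis mA : forall k, measurable (A k).
Hypothesis PA : forall k, P (A k) = (p k)%:E.
Hypothesis PAA : forall j k, (j < k)%N -> P (A j `&` A k) = (p j * p k)%:E.

Let m n : R := \sum_(0 <= k < n) p k.

Lemma event_prob_bounds k : 0 <= p k <= 1.
Proof. by rewrite -2!lee_fin -PA measure_ge0 probability_le1. Qed.

Lemma count_events_ge0 n w : 0 <= count_events n w.
Proof. by rewrite sumr_ge0. Qed.

Lemma measurable_count_events n : measurable_fun setT (count_events n).
Proof. by apply: measurable_sum => k; exact: measurable_indic. Qed.

Lemma integral_count_events n :
  (\int[P]_w (count_events n w)%:E = (m n)%:E)%E.
Proof.
under eq_integral do rewrite /count_events -sumEFin.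
rewrite ge0_integral_sum//.
- rewrite -sumEFin; apply: eq_bigr => k _.
  by rewrite integral_indic ?setIT; first exact: PA.
- by move=> k; apply/measurable_EFinP; exact: measurable_indic.
Qed.

(** Expanding the square, pairwise independence turns the off-diagonal terms
    into p j * p k, and a diagonal term is p j because an indicator is its own
    square. *)
Lemma integral_sqr_count_events n :
  (\int[P]_w (count_events n w ^+ 2)%:E <= (m n + m n ^+ 2)%:E)%E.
Proof.
have -> : (\int[P]_w (count_events n w ^+ 2)%:E =
  \sum_(0 <= j < n) \sum_(0 <= k < n) P (A j `&` A k))%E.
  transitivity (\int[P]_w (\sum_(0 <= j < n)
     (\sum_(0 <= k < n) (\1_(A j `&` A k) w)%:E)))%E.
    apply: eq_integral => w _; rewrite expr2 /count_events mulr_suml -sumEFin.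
    apply: eq_bigr => j _; rewrite mulr_sumr -sumEFin.
    by apply: eq_bigr => k _; rewrite indicI.
  rewrite ge0_integral_sum//; last by move=> j w _; rewrite sume_ge0.
    apply: eq_bigr => j _; rewrite ge0_integral_sum//.
      apply: eq_bigr => k _; rewrite integral_indic ?setIT//.
      exact: measurableI.
    move=> k; apply/measurable_EFinP; apply: measurable_indic.
    exact: measurableI.
  move=> j; apply: emeasurable_sum => k; apply/measurable_EFinP.
  by apply: measurable_indic; exact: measurableI.
have -> : m n + m n ^+ 2 =
    \sum_(0 <= j < n) \sum_(0 <= k < n) ((j == k)%:R * p j + p j * p k).
  under eq_bigr do rewrite big_split/=.
  rewrite big_split/=; congr (_ + _).
    apply: eq_big_nat => j jn; rewrite (big_rem j)/= ?mem_index_iota//.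
    rewrite eqxx mul1r big1_seq ?addr0// => k /=.
    rewrite mem_rem_uniq ?iota_uniq// inE => /andP[/negPf].
    by rewrite eq_sym => ->; rewrite mul0r.
  rewrite expr2 mulr_suml; apply: eq_bigr => j _.
  by rewrite mulr_sumr.
rewrite -sumEFin; apply: lee_sum => j _.
rewrite -sumEFin; apply: lee_sum => k _.
have [/andP[pj0 pj1] /andP[pk0 pk1]] := (event_prob_bounds j, event_prob_bounds k).
have [jk|kj|<-] := ltngtP j k.
- by rewrite PAA// mul0r add0r.
- by rewrite setIC PAA// mul0r add0r mulrC.
- by rewrite setIid PA mul1r lee_fin lerDl mulr_ge0.
Qed.

(** The second moment bound says that the variance is at most the mean. *)
Lemma chebyshev_count_events n (e : R) : 0 < e ->
  (P [set w | (e <= `|count_events n w - m n|)%R] <= (m n / e ^+ 2)%:E)%E.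
Proof.
move=> e0.
pose D w := (count_events n w - m n) ^+ 2.
have m0 : 0 <= m n by apply: sumr_ge0 => k _; case/andP: (event_prob_bounds k).
have mK := measurable_count_events n.
have mD : measurable_fun setT D.
  by apply: measurable_funX; apply: measurable_funB.
have ID : (\int[P]_w (D w)%:E <= (m n)%:E)%E.
  (* The cross term of the square is moved to the other side, so that only
     integrals of nonnegative functions occur. *)
  have IDK : (\int[P]_w (D w)%:E + (2 * m n * m n)%:E =
      \int[P]_w (count_events n w ^+ 2)%:E + ((m n) ^+ 2)%:E)%E.
    have -> : ((2 * m n * m n)%:E =
        \int[P]_w ((2 * m n)%:E * (count_events n w)%:E))%E.
      rewrite ge0_integralZl//; first by rewrite integral_count_events.
      - exact/measurable_EFinP.
      - by move=> w _; rewrite lee_fin count_events_ge0.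
      - by rewrite lee_fin mulr_ge0.
    rewrite -ge0_integralD//.
    - transitivity (\int[P]_w ((count_events n w ^+ 2)%:E + (m n ^+ 2)%:E))%E.
        apply: eq_integral => w _; rewrite -EFinM -!EFinD /D; congr (_%:E).
        ring.
      rewrite ge0_integralD//.
      + rewrite integral_cst// [X in (_ * X)%E](_ : _ = 1%E) ?mule1//.
          exact: probability_setT.
      + by move=> w _; rewrite lee_fin sqr_ge0.
      + by apply/measurable_EFinP; exact: measurable_funX.
      + by move=> w _; rewrite lee_fin sqr_ge0.
    - by move=> w _; rewrite lee_fin sqr_ge0.
    - exact/measurable_EFinP.
    - by move=> w _; rewrite -EFinM lee_fin !mulr_ge0// count_events_ge0.
    - by apply/measurable_EFinP; apply: measurable_funM.
  have : (\int[P]_w (D w)%:E + (2 * m n * m n)%:E <=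
      (m n)%:E + (2 * m n * m n)%:E)%E.
    rewrite IDK (_ : _ + _ = (m n + m n ^+ 2)%:E + (m n ^+ 2)%:E)%E.
      by rewrite leeD2r// integral_sqr_count_events.
    by rewrite -!EFinD; congr (_%:E); ring.
  by rewrite leeD2rE.
rewrite EFinM lee_pdivlMr ?exprn_gt0//.
apply: le_trans ID; rewrite muleC.
have mE : measurable [set w | e <= `|count_events n w - m n|].
  rewrite -[X in measurable X]setTI.
  apply: measurable_fun_le => //.
  apply: measurableT_comp => //; exact: measurable_funB.
rewrite -[X in (_ * P X)%E]setIT -integral_indic// -ge0_integralZl//.
- apply: ge0_le_integral => //.
  + by move=> w _; rewrite -EFinM lee_fin mulr_ge0// sqr_ge0.
  + by apply/measurable_EFinP; apply: measurable_funM => //; exact: measurable_indic.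
  + exact/measurable_EFinP.
  + move=> w _; rewrite -EFinM lee_fin indicE.
    have [/set_mem/= h|_] := boolP (w \in _); last by rewrite mulr0 sqr_ge0.
    rewrite mulr1 /D -[leRHS]real_normK ?num_real//.
    by rewrite lerXn2r// nnegrE// ltW.
- by apply/measurable_EFinP; exact: measurable_indic.
- by rewrite lee_fin sqr_ge0.
Qed.

End counting.

(** Comparison with the telescoping sum of 1 / k - 1 / (k + 1). *)
Lemma sum_inv_sqr_le2 (R : realFieldType) n :
  \sum_(0 <= k < n) (k.+1%:R ^+ 2)^-1 <= 2 :> R.
Proof.
suff h : \sum_(0 <= k < n.+1) (k.+1%:R ^+ 2)^-1 <= 2 - n.+1%:R^-1 :> R.
  apply: (@le_trans _ _ (\sum_(0 <= k < n.+1) (k.+1%:R ^+ 2)^-1)).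
    by rewrite big_nat_recr//= lerDl invr_ge0 sqr_ge0.
  by apply: le_trans h _; rewrite gerBl invr_ge0.
elim: n => [|n IH]; first by rewrite big_nat1 expr1n invr1; lra.
rewrite big_nat_recr//=.
suff h : (n.+2%:R ^+ 2)^-1 <= n.+1%:R^-1 - n.+2%:R^-1 :> R.
  by apply: le_trans (lerD IH h) _; rewrite addrA subrK.
have n1 : 0 < n.+1%:R :> R by rewrite ltr0n.
have -> : n.+2%:R = n.+1%:R + 1 :> R by rewrite -natr1.
set x : R := n.+1%:R in n1 *.
have x1 : 0 < x + 1 by lra.
have -> : x^-1 - (x + 1)^-1 = (x * (x + 1))^-1 by field; rewrite !gt_eqF.
rewrite lef_pV2 ?posrE ?mulr_gt0 ?exprn_gt0// expr2 ler_pM2r//; lra.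
Qed.

Lemma floor_sqrt (R : realType) (x : R) : 0 <= x ->
  exists j : nat, j%:R ^+ 2 <= x < j.+1%:R ^+ 2.
Proof.
move=> x0; exists (Num.truncn (Num.sqrt x)).
have s0 := sqrtr_ge0 x.
have /andP[h1 h2] := truncn_itv s0.
apply/andP; split.
  rewrite -[leRHS]sqr_sqrtr// lerXn2r ?nnegrE//.
by rewrite -[ltLHS]sqr_sqrtr// ltrXn2r ?nnegrE.
Qed.

(** Consecutive squares are close on the multiplicative scale, so that
    monotonicity of K carries the estimate from the sparse times N j, where m
    first reaches the square of j, to all times. *)
Lemma ratio_cvg1_sparse (R : realType) (K m : nat -> R) (N : nat -> nat) :
  {homo K : i j / (i <= j)%N >-> i <= j} ->
  m @ \oo --> +oo ->
  (forall j n, j%:R ^+ 2 <= m n -> (N j <= n)%N) ->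
  (forall j n, m n < j%:R ^+ 2 -> (n <= N j)%N) ->
  (forall j, j%:R ^+ 2 <= m (N j) <= j%:R ^+ 2 + 1) ->
  (forall e, 0 < e -> \forall j \near \oo, `|K (N j) - m (N j)| <= e * m (N j)) ->
  K n / m n @[n --> \oo] --> (1 : R).
Proof.
move=> ndK my Nle leN mN KmN.
apply/cvgrPdistC_le => e0 e0_gt0.
pose e := Num.min (e0 / 3) (1 / 3).
have e_gt0 : 0 < e by rewrite lt_min; apply/andP; split; lra.
have e13 : e <= 1 / 3 by rewrite ge_min lexx orbT.
have ee0 : 3 * e <= e0.
  have : e <= e0 / 3 by rewrite ge_min lexx.
  lra.
have [J _ HJ] := KmN e e_gt0.
have [J' J'e] : exists J' : nat, 5 / e <= J'%:R.
  by exists (Num.truncn (5 / e)).+1; apply/ltW/truncnS_gt.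
(* j >= 5 / e makes (j + 1)^2 + 1 <= (1 + e) j^2 and
   (1 - e) (j + 1)^2 <= j^2. *)
pose L := maxn 1 (maxn J J').
apply: filterS ((cvgryPge m).1 my (L%:R ^+ 2)) => n Ln.
have mn0 : 0 <= m n by apply: le_trans Ln; exact: sqr_ge0.
have [j /andP[j1 j2]] := floor_sqrt mn0.
have Lj : (L <= j)%N.
  rewrite -ltnS -(ltr_nat R) -(@ltr_pXn2r _ 2)// ?nnegrE//.
  exact: le_lt_trans Ln j2.
have [jge1 [jJ jJ']] : (1 <= j)%N /\ (J <= j)%N /\ (J' <= j)%N by lia.
have je : 5 <= e * j%:R.
  rewrite mulrC -ler_pdivrMr//; apply: le_trans J'e _.
  by rewrite ler_nat.
have h1 : K (N j) <= K n by apply: ndK; exact: Nle.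
have h2 : K n <= K (N j.+1) by apply: ndK; exact: leN.
have := HJ _ jJ; have := HJ j.+1 (leqW jJ).
rewrite !ler_norml => /andP[_ hu] /andP[hl _].
have /andP[a1 a2] := mN j; have /andP[b1 b2] := mN j.+1.
have jr1 : 1 <= j%:R :> R by rewrite ler1n.
move: j2 b1 b2; rewrite -natr1.
move: j1 je a1 a2 jr1 => {J'e jJ' jge1 Lj HJ}; set x : R := j%:R => j1 je a1 a2 jr1 j2 b1 b2.
have mn_gt0 : 0 < m n by apply: lt_le_trans j1; rewrite exprn_gt0//; lra.
have ex2 : 5 * x <= e * x * x by rewrite ler_wpM2r//; lra.
have e2 : e * e <= e * (1 / 3) by rewrite ler_wpM2l//; lra.
have e20 : 0 <= e * e by rewrite mulr_ge0// ltW.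
have U : K n <= (1 + 3 * e) * m n.
  have q1 : K n <= (1 + e) * ((x + 1) ^+ 2 + 1).
    apply: (@le_trans _ _ ((1 + e) * m (N j.+1))); first lra.
    by rewrite ler_pM2l//; lra.
  have q2 : (x + 1) ^+ 2 + 1 <= (1 + e) * x ^+ 2 by lra.
  have q3 : (1 + e) * ((x + 1) ^+ 2 + 1) <= (1 + e) * ((1 + e) * m n).
    rewrite ler_pM2l; last lra.
    by apply: le_trans q2 _; rewrite ler_pM2l//; lra.
  by apply: (le_trans q1); apply: (le_trans q3); rewrite mulrA ler_pM2r//; lra.
have Lo : (1 - 3 * e) * m n <= K n.
  have q1 : (1 - e) * x ^+ 2 <= K n.
    apply: (@le_trans _ _ ((1 - e) * m (N j))); last lra.
    by rewrite ler_pM2l//; lra.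
  have q2 : (1 - e) * (x + 1) ^+ 2 <= x ^+ 2 by lra.
  have q3 : (1 - e) * ((1 - e) * m n) <= (1 - e) * x ^+ 2.
    rewrite ler_pM2l; last lra.
    by apply: le_trans q2; rewrite ler_pM2l; [exact: ltW|lra].
  by apply: le_trans q1; apply: le_trans q3; rewrite mulrA ler_pM2r//; lra.
apply/andP; split.
  rewrite lerBrDr ler_pdivlMr//; apply: le_trans Lo.
  by rewrite ler_pM2r//; lra.
rewrite lerBlDr ler_pdivrMr//; apply: le_trans U _.
by rewrite ler_pM2r//; lra.
Qed.

Section strong_law.
Context d (T : measurableType d) (R : realType) (P : probability T R).
Variables (A : nat -> set T) (p : nat -> R).

(** At the first time N j at which the mean reaches the square of j,
    Chebyshev's bound on a relative deviation e is at most 1 / (e j)^2, which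
    is summable; monotonicity fills the gaps between these times. *)
Theorem strong_law_pairwise_independent_events :
  (forall k, measurable (A k)) ->
  (forall k, P (A k) = (p k)%:E) ->
  (forall j k, (j < k)%N -> P (A j `&` A k) = (p j * p k)%:E) ->
  (\sum_(0 <= k < n) p k @[n --> \oo] --> +oo) ->
  {ae P, forall w,
    count_events R A n w / (\sum_(0 <= k < n) p k) @[n --> \oo] --> (1 : R)}.
Proof.
move=> mA PA PAA my.
pose m n := \sum_(0 <= k < n) p k.
have pb := event_prob_bounds mA PA.
have ndm : {homo m : i j / (i <= j)%N >-> i <= j}.
  apply: homo_leq => // [|n]; first exact: le_trans.
  by rewrite /m big_nat_recr//= lerDl; case/andP: (pb n).
have exN j : exists n, j%:R ^+ 2 <= m n.
  by have [n _ /(_ n (leqnn n))] := (cvgryPge m).1 my (j%:R ^+ 2); exists n.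
pose N j := ex_minn (exN j).
have Nle j n : j%:R ^+ 2 <= m n -> (N j <= n)%N.
  by move=> h; rewrite /N; case: ex_minnP => k _; exact.
have mNge j : j%:R ^+ 2 <= m (N j) by rewrite /N; case: ex_minnP.
have leN j n : m n < j%:R ^+ 2 -> (n <= N j)%N.
  move=> h; rewrite leqNgt; apply/negP => /ltnW/ndm.
  by apply/negP; rewrite -ltNge; exact: lt_le_trans h (mNge j).
have mN j : j%:R ^+ 2 <= m (N j) <= j%:R ^+ 2 + 1.
  rewrite mNge/=; case E : (N j) => [|k].
    by rewrite /m big_nil addr_ge0// sqr_ge0.
  have : m k < j%:R ^+ 2.
    by rewrite ltNge; apply/negP => /Nle; rewrite E ltnn.
  rewrite {2}/m big_nat_recr//= => mk; apply: lerD; first exact: ltW.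
  by case/andP: (pb k).
have aeN (i : nat) : {ae P, forall w, \forall j \near \oo,
    `|count_events R A (N j) w - m (N j)| <= i.+1%:R^-1 * m (N j)}.
  pose e : R := i.+1%:R^-1.
  have e0 : 0 < e by rewrite invr_gt0 ltr0n.
  pose B j := [set w | e * m (N j.+1) <= `|count_events R A (N j.+1) w - m (N j.+1)|].
  have m_gt0 j : 0 < m (N j.+1).
    by apply: lt_le_trans (mNge j.+1); rewrite exprn_gt0.
  have mB j : measurable (B j).
    rewrite -[X in measurable X]setTI.
    apply: measurable_fun_le => //.
    apply: measurableT_comp => //; apply: measurable_funB => //.
    exact: measurable_count_events.
  have PB j : (P (B j) <= (e ^- 2 * (j.+1%:R ^+ 2)^-1)%:E)%E.
    have em0 : 0 < e * m (N j.+1) by rewrite mulr_gt0.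
    apply: le_trans (chebyshev_count_events mA PA PAA (N j.+1) em0) _.
    rewrite lee_fin -/(m _) exprMn invfM mulrCA ler_pM2l ?invr_gt0 ?exprn_gt0//.
    have -> : m (N j.+1) / m (N j.+1) ^+ 2 = (m (N j.+1))^-1.
      by have := m_gt0 j; move: (m _) => z z0; field; rewrite gt_eqF.
    by rewrite lef_pV2 ?posrE ?exprn_gt0.
  have sB n : \sum_(0 <= j < n) e ^- 2 * (j.+1%:R ^+ 2)^-1 <= e ^- 2 * 2 :> R.
    rewrite -mulr_sumr ler_pM2l ?invr_gt0 ?exprn_gt0//.
    exact: sum_inv_sqr_le2.
  apply: filterS (ae_eventually_notin mB PB sB) => w [J _ HJ].
  exists J.+1 => // -[//|j]/= Jj.
  by have := HJ j Jj; rewrite /B/= => /negP; rewrite -ltNge => /ltW.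
apply: filterS (ae_foralln aeN) => w Hw.
apply: (@ratio_cvg1_sparse _ (count_events R A ^~ w) m N) => //.
  apply: homo_leq => // [|n]; first exact: le_trans.
  by rewrite /count_events big_nat_recr//= lerDl.
move=> e e0.
have [i ie] : exists i : nat, i.+1%:R^-1 <= e.
  exists (Num.truncn e^-1); rewrite invf_ple ?posrE//.
  exact/ltW/truncnS_gt.
apply: filterS (Hw i) => j h; apply: le_trans h _.
by apply: ler_wpM2r => //; apply: le_trans (mNge j); exact: sqr_ge0.
Qed.

End strong_law.

(** * Records of independent uniform variables *)

(** A discrete form of the vanishing of a derivative: cutting [0, z] into N
    equal pieces, the increments of phi telescope and the bound becomes
    (phi z - phi 0) * z / N, for every N. *)
Lemma eq_of_increment_bound (R : realType) (h phi : R -> R) (z : R) :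
  0 <= z ->
  (forall s t, 0 <= s -> s <= t -> t <= z ->
    `|h t - h s| <= (phi t - phi s) * (t - s)) ->
  h z = h 0.
Proof.
move=> z0 hphi.
have key (N : nat) : `|h z - h 0| * N.+1%:R <= (phi z - phi 0) * z.
  pose t i : R := z * (i%:R / N.+1%:R).
  have N0 : 0 < N.+1%:R :> R by rewrite ltr0n.
  have dt i : t i.+1 - t i = z / N.+1%:R.
    by rewrite /t -mulrBr -mulrBl -natrB// subSnn mul1r.
  have t0 : t 0%N = 0 by rewrite /t mul0r mulr0.
  have tN : t N.+1 = z by rewrite /t divff ?mulr1// gt_eqF.
  have -> : h z - h 0 = \sum_(0 <= i < N.+1) (h (t i.+1) - h (t i)).
    by rewrite (telescope_sumr (h \o t))// /= tN t0.
  have -> : phi z - phi 0 = \sum_(0 <= i < N.+1) (phi (t i.+1) - phi (t i)).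
    by rewrite (telescope_sumr (phi \o t))// /= tN t0.
  rewrite -ler_pdivlMr// -mulrA mulr_suml.
  apply: le_trans (ler_norm_sum _ _ _) _.
  rewrite 2!big_mkord; apply: ler_sum => i _; rewrite -(dt i).
  apply: hphi.
  - by rewrite /t mulr_ge0// divr_ge0.
  - by rewrite -subr_ge0 dt divr_ge0.
  - by rewrite -tN /t ler_wpM2l// ler_pM2r ?invr_gt0// ler_nat.
apply/eqP; rewrite -subr_eq0 -normr_le0 leNgt; apply/negP => h0.
have := key (Num.truncn ((phi z - phi 0) * z / `|h z - h 0|)).
rewrite mulrC -ler_pdivlMr// leNgt => /negP; apply.
exact: truncnS_gt.
Qed.

Section exceed.
Context d (T : measurableType d) (R : realType) (P : probability T R).
Variables (G : R -> set T) (Q : set T) (Z : T -> R) (c : R) (a : nat).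
Hypothesis mG : forall y, measurable (G y).
Hypothesis mQ : measurable Q.
Hypothesis mZ : measurable_fun setT Z.
Hypothesis GQ : forall y, G y `&` [set w | y < Z w] `<=` Q.
Hypothesis QG : forall y, Q `&` [set w | Z w <= y] `<=` G y.
Hypothesis c_ge0 : 0 <= c.
Hypothesis PZ0 : P [set w | Z w <= 0] = 0%E.
Hypothesis PGZ : forall y s t, 0 <= y <= 1 -> 0 <= s -> s <= t -> t <= 1 ->
  P (G y `&` [set w | s < Z w <= t]) = (c * y ^+ a * (t - s))%:E.

(** Here Q stands for E /\ {Y < Z} and G y for E /\ {Y <= y}, where Z is uniform
    and independent of (E, Y) and P (G y) = c * y ^+ a, so that the probability
    is the integral of c * y ^+ a over [0, z].  When s < Z <= t, the event Q
    lies between G s and G t.  This determines the increments of the left-hand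
    side up to the error allowed by [eq_of_increment_bound]. *)
Lemma prob_exceed z : 0 <= z <= 1 ->
  P (Q `&` [set w | Z w <= z]) = (c * (z ^+ a.+1 / a.+1%:R))%:E.
Proof.
move=> /andP[z0 z1].
have mle t : measurable [set w | Z w <= t].
  by rewrite -[X in measurable X]setTI; exact: measurable_fun_le.
have mst s t : measurable [set w | s < Z w <= t].
  rewrite -[X in measurable X]setTI (_ : [set w | _] = Z @^-1` `]s, t]).
    exact: (mZ measurableT).
  by apply/seteqP; split => w /=; rewrite in_itv.
pose f t := fine (P (Q `&` [set w | Z w <= t])).
have fE t : P (Q `&` [set w | Z w <= t]) = (f t)%:E.
  by rewrite fineK// fin_num_measure//; exact: measurableI.
have f0 : f 0 = 0.
  apply/eqP; rewrite -eqe -fE eq_le measure_ge0 andbT.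
  apply: (@le_trans _ _ (P [set w | Z w <= 0])); last by rewrite PZ0.
  by apply: le_measure; rewrite ?inE; [exact: measurableI|exact: mle|exact: subIsetr].
have finc s t : 0 <= s -> s <= t -> t <= z ->
    c * s ^+ a * (t - s) <= f t - f s <= c * t ^+ a * (t - s).
  move=> s0 st tz.
  have t1 : t <= 1 by exact: le_trans tz z1.
  have D : P (Q `&` [set w | s < Z w <= t]) = (f t - f s)%:E.
    rewrite EFinB; apply/eqP; rewrite eq_sym sube_eq//; last first.
      by rewrite fin_num_adde_defl.
    rewrite -!fE; apply/eqP.
    rewrite -measureU; [|exact: measurableI..|].
      congr (P _); apply/seteqP; split => w /=.
        by move=> [Qw wt]; case: (leP (Z w) s) => ?; [right|left]; split => //; apply/andP.
      move=> [[Qw /andP[_ ?]]|[Qw ?]]; split => //.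
      by apply: le_trans st.
    apply/seteqP; split => w //= [[_ /andP[+ _]] [_ +]].
    by rewrite ltNge => /negP.
  rewrite -2!lee_fin -D; apply/andP; split.
    rewrite -PGZ//; last by rewrite s0 (le_trans st).
    apply: le_measure; rewrite ?inE; [exact: measurableI..|].
    move=> w [/= Gw /andP[sw wt]]; split; last by apply/andP.
    by apply: (GQ (y := s)).
  rewrite -PGZ//; last by rewrite t1 (le_trans s0).
  apply: le_measure; rewrite ?inE; [exact: measurableI..|].
  move=> w [/= Gw /andP[sw wt]]; split; last by apply/andP.
  by apply: QG.
pose g (t : R) := c * (t ^+ a.+1 / a.+1%:R).
have ginc s t : 0 <= s -> s <= t ->
    c * s ^+ a * (t - s) <= g t - g s <= c * t ^+ a * (t - s).
  move=> s0 st.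
  have ts : 0 <= t - s by rewrite subr_ge0.
  have t0 : 0 <= t by exact: le_trans st.
  have F x : c * x ^+ a * (t - s) = c * ((t - s) * x ^+ a).
    by rewrite -mulrA (mulrC (x ^+ a)).
  rewrite /g -mulrBr -mulrBl subrXX -(mulrA (t - s)) !F.
  have K (x : R) : x * a.+1%:R = \sum_(i < a.+1) x.
    by rewrite sumr_const card_ord mulr_natr.
  have Ea (x : R) (i : 'I_a.+1) : x ^+ a = x ^+ (a - i) * x ^+ i.
    by rewrite -exprD subnK// -ltnS.
  apply/andP; split; do 2! apply: ler_wpM2l => //.
    rewrite ler_pdivlMr ?ltr0n// K; apply: ler_sum => i _.
    rewrite /= (Ea s i); apply: ler_wpM2r; first exact: exprn_ge0.
    by rewrite lerXn2r ?nnegrE.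
  rewrite ler_pdivrMr ?ltr0n// K; apply: ler_sum => i _.
  rewrite /= (Ea t i); apply: ler_wpM2l; first exact: exprn_ge0.
  by rewrite lerXn2r ?nnegrE.
rewrite fE -/(g z); congr (_%:E).
have /(eq_of_increment_bound z0) : forall s t, 0 <= s -> s <= t -> t <= z ->
    `|(f \- g) t - (f \- g) s| <= (c * t ^+ a - c * s ^+ a) * (t - s).
  move=> s t s0 st tz.
  have /andP[] := finc s t s0 st tz; have /andP[] := ginc s t s0 st.
  rewrite /= ler_norml mulrBl => *; apply/andP; split; lra.
rewrite /= f0 {2}/g expr0n/= mul0r mulr0 subr0 => /eqP.
by rewrite subr_eq0 => /eqP.
Qed.

End exceed.

Section independence.
Context d (T : measurableType d) (R : realType) (P : probability T R).
Variable X : nat -> {RV P >-> R}.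

Lemma measurable_RV_preimage k (A : set R) :
  measurable A -> measurable (X k @^-1` A).
Proof. by move=> mA; rewrite -[_ @^-1` _]setTI; exact: measurable_funPT. Qed.

Lemma measurable_RV_le k x : measurable [set w | X k w <= x].
Proof. by rewrite -[X in measurable X]setTI; exact: measurable_fun_le. Qed.

Definition box (m n : nat) (A : nat -> set R) : set T :=
  [set w | forall k, (m <= k < n)%N -> A k (X k w)].

Lemma measurable_box m n A : (forall k, measurable (A k)) ->
  measurable (box m n A).
Proof.
move=> mA; rewrite (_ : box m n A = \bigcap_(k in [set k | m <= k < n]%N) (X k @^-1` A k)).
  by apply: bigcap_measurableType => k _; exact: measurable_RV_preimage.
by apply/seteqP; split => w /= h k; apply: h.
Qed.

Lemma prob_box m n A : independent_RVs X -> (forall k, measurable (A k)) ->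
  P (box m n A) = (\prod_(m <= k < n) fine (P (X k @^-1` A k)))%:E.
Proof.
move=> indX mA.
have := indX [fset k in index_iota m n]%fset A (fun k _ => mA k).
have -> : \bigcap_(i in [set` [fset k in index_iota m n]%fset]) (X i @^-1` A i) = box m n A.
  apply/seteqP; split => w h k /=.
    by move=> mkn; apply: h; rewrite /= !inE mem_index_iota.
  by rewrite !inE mem_index_iota; exact: h.
move=> ->.
rewrite (perm_big (index_iota m n)); last first.
  apply: uniq_perm; rewrite ?fset_uniq ?iota_uniq// => k.
  by rewrite !inE.
rewrite -prodEFin; apply: eq_bigr => k _.
rewrite fineK// fin_num_measure//; exact: measurable_RV_preimage.
Qed.

End independence.

Section uniform_records.
Context d (T : measurableType d) (R : realType) (P : probability T R).
Variable U : nat -> {RV P >-> R}.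
Hypothesis U_indep : independent_RVs U.
Hypothesis U_unif : forall k (u : R), 0 <= u <= 1 -> cdf (U k) u = u%:E.

Definition record_event (n : nat) : set T :=
  [set w | forall k, (k < n)%N -> U k w < U n w].

Lemma measurable_record_event n : measurable (record_event n).
Proof.
rewrite (_ : record_event n = \bigcap_(k in `I_n) [set w | U k w < U n w]); last first.
  by apply/seteqP; split => w /= h k; apply: h.
apply: bigcap_measurableType => k _.
rewrite -[X in measurable X]setCK; apply: measurableC.
rewrite (_ : ~` _ = setT `&` [set w | U n w <= U k w]).
  by apply: measurable_fun_le.
by rewrite setTI; apply/seteqP; split => w /=; rewrite leNgt => /negP.
Qed.

Lemma prob_U_le k u : 0 <= u <= 1 -> P [set w | U k w <= u] = u%:E.
Proof.
move=> u01; rewrite -(U_unif k u01) /cdf /distribution/pushforward.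
by congr (P _); apply/seteqP; split => w /=; rewrite in_itv.
Qed.

Lemma prob_U_in k s t : 0 <= s -> s <= t -> t <= 1 ->
  P (U k @^-1` `]s, t]) = (t - s)%:E.
Proof.
move=> s0 st t1.
have s01 : 0 <= s <= 1 by rewrite s0 (le_trans st).
have t01 : 0 <= t <= 1 by rewrite t1 (le_trans s0).
rewrite EFinB -(prob_U_le k s01) -(prob_U_le k t01).
have mle u : measurable [set w | U k w <= u] by exact: measurable_RV_le.
rewrite -[X in X = _](_ : P ([set w | U k w <= t] `\` [set w | U k w <= s]) = _).
  rewrite measureD//; last exact: le_lt_trans (probability_le1 _ (mle t)) (ltry 1).
  congr (_ - P _)%E; apply/seteqP; split => w /=; first by case.
  by move=> h; split => //; exact: le_trans st.
congr (P _); apply/seteqP; split => w /=; rewrite in_itv/=.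
  by move=> [wt /negP]; rewrite -ltNge wt => ->.
by move=> /andP[sw ->]; split => //; apply/negP; rewrite -ltNge.
Qed.

(** Given U m = u there is a record at m with probability u ^+ m,
    independently of the later variables; the quotient is the integral of
    u ^+ m up to y. *)
Lemma prob_record_le_box m n (B : nat -> set R) (y : R) :
  (m < n)%N -> (forall k, measurable (B k)) -> 0 <= y <= 1 ->
  P (record_event m `&` box U m.+1 n B `&` [set w | U m w <= y]) =
  ((\prod_(m.+1 <= k < n) fine (P (U k @^-1` B k))) * (y ^+ m.+1 / m.+1%:R))%:E.
Proof.
move=> mn mB y01.
apply: (@prob_exceed _ _ _ P
  (fun y => box U 0 m (fun=> `]-oo, y]%classic) `&` box U m.+1 n B)) => //.
- by move=> z; apply: measurableI; exact: measurable_box.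
- apply: measurableI; first exact: measurable_record_event.
  exact: measurable_box.
- move=> z w [[/= h1 h2] zw]; split => // k km.
  by have := h1 k km; rewrite /= in_itv/= => /le_lt_trans; exact.
- move=> z w [[/= h1 h2] wz]; split => // k /= km.
  by rewrite in_itv/= ltW// (lt_le_trans (h1 k km)).
- by apply: prodr_ge0 => k _; exact: fine_ge0.
- by rewrite prob_U_le// lexx ler01.
- move=> z s t z01 s0 st t1.
  pose A k := if (k < m)%N then `]-oo, z]%classic else if k == m then `]s, t]%classic else B k.
  have mA k : measurable (A k) by rewrite /A; case: ifP => // _; case: ifP.
  rewrite (_ : _ `&` _ = box U 0 n A); last first.
    apply/seteqP; split => w.
      move=> [[h1 h2] h3] k /= kn; rewrite /A.
      case: ltnP => km; first exact: h1.
      case: eqVneq => [->|kNm]; first by rewrite /= in_itv.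
      by apply: h2; lia.
    move=> h; split; first split.
    + by move=> k /= km; have := h k; rewrite /A km; apply; lia.
    + move=> k /= /andP[mk kn]; have := h k.
      by rewrite /A [(k < m)%N]ltnNge (ltnW mk) gtn_eqF//=; exact.
    + by have := h m; rewrite /A ltnn eqxx/= in_itv/=; apply.
  rewrite prob_box//; congr (_%:E).
  rewrite (@big_cat_nat _ _ _ m)//=; last exact: ltnW.
  rewrite (big_ltn mn) /=.
  have -> : \prod_(0 <= k < m) fine (P (U k @^-1` A k)) = z ^+ m.
    rewrite -[in RHS](subn0 m) -prodr_const_nat; apply: eq_big_nat => k /= km.
    have -> : U k @^-1` A k = [set w | U k w <= z].
      by apply/seteqP; split => w; rewrite /A km /= in_itv.
    by rewrite prob_U_le.
  have -> : fine (P (U m @^-1` A m)) = t - s.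
    by rewrite /A ltnn eqxx prob_U_in.
  have -> : \prod_(m.+1 <= k < n) fine (P (U k @^-1` A k)) =
            \prod_(m.+1 <= k < n) fine (P (U k @^-1` B k)).
    apply: eq_big_nat => k /andP[mk _].
    by rewrite /A ltnNge ltnW//= gtn_eqF.
  ring.
Qed.

Lemma prob_setI_U_le1 k (A : set T) : measurable A ->
  P (A `&` [set w | U k w <= 1]) = P A.
Proof.
move=> mA.
have mle : measurable [set w | U k w <= 1] by exact: measurable_RV_le.
have h0 : P (~` [set w | U k w <= 1]) = 0%E.
  by rewrite probability_setC// prob_U_le ?ler01 ?lexx// subee.
rewrite [RHS](measureDI P mA mle) [X in _ = (X + _)%E](_ : _ = 0%E) ?add0e//.
apply: subset_measure0 h0 => //; first exact: measurableD.
exact: measurableC.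
Qed.

(** The case y = 1 of the previous formula, without later variables. *)
Theorem prob_record_event n : P (record_event n) = (n.+1%:R^-1)%:E.
Proof.
have := @prob_record_le_box n n.+1 (fun=> setT) 1 (ltnSn n) (fun=> measurableT).
rewrite prob_setI_U_le1; last first.
  apply: measurableI; first exact: measurable_record_event.
  exact: measurable_box.
rewrite big_geq// expr1n !mul1r ler01 lexx => /(_ isT) <-; congr (P _).
apply/seteqP; split => w; last by case.
by move=> h; split => // k.
Qed.

(** If there is a record at m, then the first n values are at most y as soon as
    U m and the values between m and n are.  By [prob_record_le_box] this has
    probability y ^+ n / m.+1, which is the law of the maximum of n variables
    up to the factor 1 / m.+1: the record at m does not influence whether U n
    exceeds its predecessors. *)
Theorem record_events_pairwise_independent m n : (m < n)%N ->
  P (record_event m `&` record_event n) = (m.+1%:R^-1 * n.+1%:R^-1)%:E.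
Proof.
move=> mn.
rewrite -(@prob_setI_U_le1 n); last by apply: measurableI; exact: measurable_record_event.
have -> : m.+1%:R^-1 * n.+1%:R^-1 = m.+1%:R^-1 * (1 ^+ n.+1 / n.+1%:R) :> R.
  by rewrite expr1n mul1r.
apply: (@prob_exceed _ _ _ P
  (fun y => record_event m `&` box U 0 n (fun=> `]-oo, y]%classic))) => //.
- move=> z; apply: measurableI; last exact: measurable_box.
  exact: measurable_record_event.
- by apply: measurableI; exact: measurable_record_event.
- move=> z w [[/= h1 h2] zw]; split => // k km.
  by have := h2 k km; rewrite /= in_itv/= => /le_lt_trans; exact.
- move=> z w [[/= h1 h2] wz]; split => // k /= km.
  by rewrite in_itv/= ltW// (lt_le_trans (h2 k km)).
- by rewrite prob_U_le// lexx ler01.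
- move=> z s t z01 s0 st t1.
  pose B k := if (k < n)%N then `]-oo, z]%classic else `]s, t]%classic : set R.
  have mB k : measurable (B k) by rewrite /B; case: ifP.
  rewrite (_ : _ `&` _ = record_event m `&` box U m.+1 n.+1 B `&` [set w | U m w <= z]); last first.
    apply/seteqP; split => w.
      move=> [[h1 h2] h3]; split; first split => //.
        move=> k /= kn; rewrite /B; case: ltnP => kn'; first exact: h2.
        by have -> : k = n by [lia]; rewrite /= in_itv.
      by have := h2 m mn; rewrite /= in_itv.
    move=> [[h1 h2] h3]; split; first split => //.
      move=> k /= kn; rewrite in_itv/=.
      have [km|mk|->//] := ltngtP k m.
        by apply: ltW; apply: lt_le_trans h3; exact: h1.
      by have := h2 k; rewrite /B kn /= in_itv/=; apply; lia.
    by have := h2 n; rewrite /B ltnn/= in_itv/=; apply; lia.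
  rewrite prob_record_le_box//; last exact: ltnW.
  congr (_%:E).
  rewrite big_nat_recr//= {2}/B ltnn prob_U_in//=.
  have -> : \prod_(m.+1 <= k < n) fine (P (U k @^-1` B k)) = z ^+ (n - m.+1).
    rewrite -prodr_const_nat; apply: eq_big_nat => k /andP[_ kn].
    have -> : U k @^-1` B k = [set w | U k w <= z].
      by apply/seteqP; split => w; rewrite /B kn /= in_itv.
    by rewrite prob_U_le.
  have {2}-> : n = (n - m.+1 + m.+1)%N by rewrite subnK.
  by rewrite exprD; ring.
by rewrite ler01 lexx.
Qed.

End uniform_records.

(** * Exponential variables: reduction to the uniform law, extreme values *)

Section exponential.
Context d (T : measurableType d) (R : realType) (P : probability T R).
Variables (lambda : R) (X : nat -> {RV P >-> R}).
Hypothesis lambda_gt0 : 0 < lambda.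
Hypothesis X_indep : independent_RVs X.
Hypothesis X_exp : forall k, exponentially_distributed lambda (X k).

Lemma prob_exp_le k (x : R) : 0 <= x ->
  P [set w | X k w <= x] = (1 - expR (- lambda * x))%:E.
Proof.
move=> x0; rewrite -(X_exp k x0) /cdf /distribution/pushforward.
by congr (P _); apply/seteqP; split => w /=; rewrite in_itv.
Qed.

Lemma prob_exp_gt k (x : R) : 0 <= x ->
  P [set w | x < X k w] = (expR (- lambda * x))%:E.
Proof.
move=> x0.
have mle : measurable [set w | X k w <= x] by exact: measurable_RV_le.
rewrite (_ : [set w | x < X k w] = ~` [set w | X k w <= x]); last first.
  by apply/seteqP; split => w /=; rewrite ltNge => /negP.
rewrite probability_setC// prob_exp_le// -EFinB; congr (_%:E).
by rewrite opprB addrC subrK.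
Qed.

Definition exp_cdf (x : R) : R := 1 - expR (- lambda * x).

Lemma measurable_exp_cdf : measurable_fun setT exp_cdf.
Proof.
by apply: measurable_funB => //; apply: measurableT_comp.
Qed.

HB.instance Definition _ := isMeasurableFun.Build _ _ _ _ _ measurable_exp_cdf.

(** Composing with the common distribution function gives uniform variables
    and, this function being increasing, does not change the records. *)
Definition uniformized (k : nat) : {RV P >-> R} := exp_cdf \o X k.

Lemma exp_cdf_lt : {mono exp_cdf : x y / x < y}.
Proof. by move=> x y; rewrite /exp_cdf ltrD2l ltrN2 ltr_expR !mulNr ltrN2 ltr_pM2l. Qed.

Lemma uniformized_indep : independent_RVs uniformized.
Proof.
move=> J A mA.
apply: (X_indep (A := fun k => exp_cdf @^-1` A k)) => i iJ.
rewrite -[X in measurable X]setTI; apply: measurable_exp_cdf => //.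
exact: mA.
Qed.

Lemma uniformized_unif k (u : R) : 0 <= u <= 1 -> cdf (uniformized k) u = u%:E.
Proof.
move=> /andP[u0 u1].
rewrite /cdf /distribution/pushforward/uniformized.
have [u1'|] := ltP u 1; last first.
  move=> u1'; have -> : u = 1 by apply/eqP; rewrite eq_le u1.
  rewrite -[RHS](probability_setT P); congr (P _); apply/seteqP; split => // w _.
  by rewrite /= in_itv/= gerBl expR_ge0.
have q0 : 0 < 1 - u by rewrite subr_gt0.
pose x := - ln (1 - u) / lambda.
have x0 : 0 <= x.
  by rewrite /x divr_ge0 ?(ltW lambda_gt0)// oppr_ge0 ln_le0// gerBl.
have ex : exp_cdf x = u.
  rewrite /exp_cdf /x mulNr mulrC divfK ?gt_eqF// opprK lnK ?posrE//.
  by rewrite opprB addrC subrK.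
transitivity (P [set w | X k w <= x]); last by rewrite prob_exp_le// -/(exp_cdf x) ex.
congr (P _); apply/seteqP; split => w /=; rewrite in_itv/= -{1}ex.
  by rewrite !leNgt exp_cdf_lt.
by rewrite !leNgt exp_cdf_lt.
Qed.

Lemma record_event_uniformized n : record_event X n = record_event uniformized n.
Proof.
apply/seteqP; split => w h k kn; have := h k kn; rewrite /uniformized /=.
  by rewrite exp_cdf_lt.
by rewrite exp_cdf_lt.
Qed.

End exponential.

Lemma expR_natM_ln2 (R : realType) (j : nat) : expR (j%:R * ln 2) = (2 ^ j)%:R :> R.
Proof. by rewrite expRM_natl lnK ?posrE// natrX. Qed.

Lemma dyadic_block n : (0 < n)%N -> exists j, (2 ^ j <= n < 2 ^ j.+1)%N.
Proof. by move=> n0; exists (trunc_log 2 n); rewrite trunc_logP// trunc_log_ltn. Qed.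

Lemma ln_dyadic (R : realType) (n j : nat) : (2 ^ j <= n < 2 ^ j.+1)%N ->
  j%:R * ln (2 : R) <= ln (n%:R : R) < j.+1%:R * ln (2 : R).
Proof.
move=> /andP[jn nj].
have n0 : (0 < n)%N by apply: leq_trans jn; rewrite expn_gt0.
have n0' : (0 : R) < n%:R by rewrite ltr0n.
by rewrite -ler_expR -ltr_expR !expR_natM_ln2 lnK ?posrE// ler_nat ltr_nat jn.
Qed.

Section tails.
Context d (T : measurableType d) (R : realType) (P : probability T R).
Variables (lambda : R) (X : nat -> {RV P >-> R}).
Hypothesis lambda_gt0 : 0 < lambda.
Hypothesis X_indep : independent_RVs X.
Hypothesis X_exp : forall k, exponentially_distributed lambda (X k).

Let q (e : R) : R := expR (- e * ln 2).

Let q01 e : 0 < e -> 0 < q e /\ `|q e| < 1.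
Proof.
move=> e0; rewrite ger0_norm ?expR_ge0// /q; split; first exact: expR_gt0.
by rewrite expR_lt1 mulNr oppr_lt0 mulr_gt0// ln_gt0// ltr1n.
Qed.

Let qX e j : q e ^+ j = expR (- (e * (j%:R * ln 2))).
Proof. by rewrite /q -expRM_natl; congr expR; ring. Qed.

(** Union bound on dyadic blocks: one of the first 2 ^ j.+1 variables exceeds
    (1 + e) ln (2 ^ j) / lambda with probability at most 2 * 2 ^ (- e j). *)
Lemma ae_eventually_exp_le (e : R) : 0 < e ->
  {ae P, forall w, \forall n \near \oo, X n w <= (1 + e) * ln n%:R / lambda}.
Proof.
move=> e0; have [q0 q1] := q01 e0.
have l2 : 0 < ln 2 :> R by rewrite ln_gt0// ltr1n.
pose x j : R := (1 + e) * (j%:R * ln 2) / lambda.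
have x0 j : 0 <= x j by rewrite divr_ge0 ?mulr_ge0 ?addr_ge0// ltW.
pose A j := \big[setU/set0]_(k < 2 ^ j.+1) [set w | x j < X k w].
have mgt j k : measurable [set w | x j < X k w].
  rewrite (_ : [set w | _] = X k @^-1` `]x j, +oo[).
    exact: measurable_RV_preimage.
  by apply/seteqP; split => w /=; rewrite in_itv/= andbT.
have mA j : measurable (A j) by apply: bigsetU_measurable.
have PA j : (P (A j) <= (2 * q e ^+ j)%:E)%E.
  apply: (@le_trans _ _ (\sum_(k < 2 ^ j.+1) P [set w | (x j < X k w)%R])%E).
    by apply: (@Boole_inequality _ _ _ P (fun k => [set w | x j < X k w])).
  rewrite (eq_bigr (fun=> (expR (- lambda * x j))%:E)); last first.
    by move=> k _; exact: prob_exp_gt.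
  rewrite sumEFin lee_fin sumr_const card_ord -[leLHS]mulr_natl.
  rewrite qX expnS natrM -mulrA ler_pM2l// -expR_natM_ln2 -expRD ler_expR.
  have -> : - lambda * x j = - ((1 + e) * (j%:R * ln 2)).
    by rewrite /x mulNr mulrC divfK// gt_eqF.
  by rewrite le_eqVlt; apply/orP; left; apply/eqP; ring.
have sA n : \sum_(0 <= j < n) 2 * q e ^+ j <= 2 / (1 - q e).
  exact: (@geometric_le_lim _ n 2 (q e)).
apply: filterS (ae_eventually_notin mA PA sA) => w [J _ HJ].
exists (2 ^ J)%N => // n /= Jn.
have n0 : (0 < n)%N by apply: leq_trans Jn; rewrite expn_gt0.
have [j jn] := dyadic_block n0; have /andP[jn1 _] := ln_dyadic R jn.
have /andP[_ nj] := jn.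
have Jj : (J <= j)%N.
  by have := leq_ltn_trans Jn nj; rewrite ltn_exp2l.
apply: (@le_trans _ _ (x j)); last first.
  by rewrite ler_pM2r ?invr_gt0// ler_wpM2l// addr_ge0// ltW.
rewrite leNgt; apply/negP => h; apply: (HJ j Jj).
by rewrite /A -(bigcup_mkord _ (fun k => [set w | x j < X k w])); exists n.
Qed.

(** With r = P (X k > x), the first 2 ^ j variables are all at most x with
    probability (1 - r) ^+ (2 ^ j) <= exp (- 2 ^ j r) <= 1 / (2 ^ j r).  At
    x = (1 - e) ln (2 ^ j.+1) / lambda this is a multiple of 2 ^ (- e j). *)
Lemma ae_eventually_exists_exp_gt (e : R) : 0 < e < 1 ->
  {ae P, forall w, \forall n \near \oo,
    exists2 k, (k < n)%N & (1 - e) * ln n%:R / lambda <= X k w}.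
Proof.
move=> /andP[e0 e1]; have [q0 q1] := q01 e0.
have l2 : 0 < ln 2 :> R by rewrite ln_gt0// ltr1n.
have e1' : 0 <= 1 - e by rewrite subr_ge0 ltW.
pose x j : R := (1 - e) * (j.+1%:R * ln 2) / lambda.
have x0 j : 0 <= x j by rewrite divr_ge0 ?mulr_ge0// ltW.
pose A j := box X 0 (2 ^ j) (fun=> `]-oo, x j]%classic).
have mA j : measurable (A j) by apply: measurable_box.
have PA j : (P (A j) <= (expR ((1 - e) * ln 2) * q e ^+ j)%:E)%E.
  rewrite prob_box// lee_fin.
  pose r := expR (- lambda * x j).
  have r0 : 0 < r by exact: expR_gt0.
  have r1 : 0 <= 1 - r by rewrite subr_ge0 -expR0 ler_expR mulNr oppr_le0 mulr_ge0// ltW.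
  have -> : \prod_(0 <= k < 2 ^ j) fine (P (X k @^-1` `]-oo, x j]%classic)) = (1 - r) ^+ (2 ^ j).
    rewrite -[in RHS](subn0 (2 ^ j)%N) -prodr_const_nat; apply: eq_bigr => k _.
    have -> : X k @^-1` `]-oo, x j]%classic = [set w | X k w <= x j].
      by apply/seteqP; split => w /=; rewrite in_itv.
    by rewrite (prob_exp_le X_exp).
  apply: (@le_trans _ _ (expR (- r) ^+ (2 ^ j))).
    rewrite lerXn2r ?nnegrE// ?expR_ge0//.
    exact: expR_ge1Dx.
  have N0 : 0 < (2 ^ j)%:R :> R by rewrite ltr0n expn_gt0.
  rewrite -expRM_natl mulrN expRN.
  apply: (@le_trans _ _ ((2 ^ j)%:R * r)^-1).
    rewrite lef_pV2 ?posrE ?expR_gt0 ?mulr_gt0//.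
    by apply: le_trans (expR_ge1Dx _); rewrite lerDr.
  rewrite -expR_natM_ln2 /r -expRD -expRN qX -expRD ler_expR.
  have -> : - lambda * x j = - ((1 - e) * (j.+1%:R * ln 2)).
    by rewrite /x mulNr mulrC divfK// gt_eqF.
  by rewrite -natr1 le_eqVlt; apply/orP; left; apply/eqP; ring.
have sA n : \sum_(0 <= j < n) expR ((1 - e) * ln 2) * q e ^+ j <= expR ((1 - e) * ln 2) / (1 - q e).
  apply: (@geometric_le_lim _ n _ (q e)) => //; exact: expR_ge0.
apply: filterS (ae_eventually_notin mA PA sA) => w [J _ HJ].
exists (2 ^ J)%N => // n /= Jn.
have n0 : (0 < n)%N by apply: leq_trans Jn; rewrite expn_gt0.
have [j jn] := dyadic_block n0; have /andP[_ jn1] := ln_dyadic R jn.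
have /andP[jn' nj] := jn.
have Jj : (J <= j)%N.
  by have := leq_ltn_trans Jn nj; rewrite ltn_exp2l.
have := HJ j Jj; rewrite /A /box/= => /existsNP[k /not_implyP[/= kj /negP]].
rewrite in_itv/= -ltNge => xk; exists k; first exact: leq_trans kj jn'.
apply: le_trans (ltW xk); rewrite ler_pM2r ?invr_gt0// ler_wpM2l//.
exact: ltW.
Qed.

End tails.

(** * Asymptotics of real sequences *)

Lemma exists_invn_le (R : realType) (e : R) : 0 < e ->
  exists i : nat, i.+2%:R^-1 <= e.
Proof.
move=> e0; exists (Num.truncn e^-1); rewrite invf_ple ?posrE//.
by apply: le_trans (ltW (truncnS_gt _)) _; rewrite ler_nat.
Qed.

(** Stolz-Cesaro.  The ratio of the increments is expressed without a division
    because b may be stationary, as counting functions are. *)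
Lemma cvg_ratio_increments (R : realType) (a b : nat -> R) :
  {homo b : i j / (i <= j)%N >-> i <= j} -> b @ \oo --> +oo ->
  (forall e, 0 < e -> \forall n \near \oo,
    `|(a n.+1 - a n) - (b n.+1 - b n)| <= e * (b n.+1 - b n)) ->
  a n / b n @[n --> \oo] --> (1 : R).
Proof.
move=> ndb by_ hab; apply/cvgrPdistC_le => e e0.
have e20 : 0 < e / 2 by rewrite divr_gt0.
have [N _ HN] := hab _ e20.
pose C := `|a N - b N| + (e / 2) * `|b N|.
have bnd n : (N <= n)%N -> `|a n - b n| <= e / 2 * b n + C.
  move=> /subnK <-; elim: (n - N)%N => [|k IH].
    rewrite add0n /C; have := ler_norm (- b N); rewrite normrN => h.
    have := ler_wpM2l (ltW e20) h; lra.
  have := HN (k + N)%N (leq_addl _ _); rewrite addSn => h.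
  have -> : a (k + N).+1 - b (k + N).+1 =
    (a (k + N)%N - b (k + N)%N) + ((a (k + N).+1 - a (k + N)%N) - (b (k + N).+1 - b (k + N)%N)) by ring.
  by apply: le_trans (ler_normD _ _) _; move: h IH; lra.
have hb : \forall n \near \oo, Num.max 1 (C / (e / 2)) <= b n.
  exact: (cvgryPge b).1.
apply: (filterS2 _ _ (nbhs_infty_ge N) hb) => n /= Nn; rewrite ge_max => /andP[b1 bC].
have b0 : 0 < b n by lra.
have -> : a n / b n - 1 = (a n - b n) / b n by rewrite mulrBl divff// gt_eqF.
rewrite normrM normfV (gtr0_norm b0) ler_pdivrMr//.
apply: le_trans (bnd _ Nn) _.
by move: bC; rewrite ler_pdivrMr//; lra.
Qed.

Lemma cvg_ln_nat (R : realType) : ln n%:R @[n --> \oo] --> (+oo : set_system R).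
Proof.
apply/cvgryPge => A.
exists (Num.truncn (expR A)).+1 => // n /= An.
have An' : expR A <= n%:R.
  by apply: le_trans (ltW (truncnS_gt _)) _; rewrite ler_nat.
rewrite -ler_expR lnK// posrE; apply: lt_le_trans An'.
exact: expR_gt0.
Qed.

Lemma cvg_inv_pinfty (R : realType) (T : Type) (F : set_system T)
    {FF : Filter F} (f : T -> R) :
  f t @[t --> F] --> +oo -> (f t)^-1 @[t --> F] --> (0 : R).
Proof.
move=> fy; apply/gtr0_cvgV0 => //.
by apply: filterS ((cvgryPge f).1 fy 1) => t; exact: lt_le_trans.
Qed.

Lemma ln_succ_bounds (R : realType) (x : R) : 0 < x ->
  (x + 1)^-1 <= ln (x + 1) - ln x <= x^-1.
Proof.
move=> x0; have x1 : 0 < x + 1 by lra.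
apply/andP; split.
  rewrite -opprB -ln_div ?posrE//.
  have -> : x / (x + 1) = 1 + - (x + 1)^-1 by field; rewrite gt_eqF.
  rewrite lerNr; apply: le_ln1Dx; rewrite ltrN2 invf_lt1//; lra.
rewrite -ln_div ?posrE//.
have -> : (x + 1) / x = 1 + x^-1 by field; rewrite gt_eqF.
by apply: le_ln1Dx; have : 0 < x^-1 by [rewrite invr_gt0]; lra.
Qed.

Lemma harmonic_sum_bounds (R : realType) n : (0 < n)%N ->
  ln (n.+1%:R : R) <= \sum_(0 <= k < n) k.+1%:R^-1 <= 1 + ln (n%:R : R).
Proof.
case: n => // n _; elim: n => [|n /andP[IH1 IH2]].
  rewrite big_nat1 invr1 ln1 addr0 lexx andbT.
  by have := @le_ln1Dx R 1; rewrite -[2%:R]/(1 + 1); apply; lra.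
have n0 : (0 : R) < n.+1%:R by rewrite ltr0n.
have n1 : (0 : R) < n.+2%:R by rewrite ltr0n.
rewrite big_nat_recr//=.
have /andP[_ h1] := ln_succ_bounds n1; rewrite natr1 in h1.
have /andP[h2 _] := ln_succ_bounds n0; rewrite natr1 in h2.
by apply/andP; split; [move: IH1 h1|move: IH2 h2];
  move: (ln _) (ln _) (_^-1) (\sum_(_ <= _ < _) _) => *; lra.
Qed.

Lemma cvg_1D_inv_ln (R : realType) : 1 + (ln n%:R)^-1 @[n --> \oo] --> (1 : R).
Proof.
rewrite -[X in _ --> X]addr0; apply: cvgD; first exact: cvg_cst.
by apply: cvg_inv_pinfty; exact: cvg_ln_nat.
Qed.

Lemma cvg_harmonic_ln (R : realType) :
  (\sum_(0 <= k < n) k.+1%:R^-1) / ln n%:R @[n --> \oo] --> (1 : R).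
Proof.
apply: squeeze_cvgr (@cvg_1D_inv_ln R); last exact: cvg_cst.
apply: (filterS2 _ _ (nbhs_infty_ge 2) ((cvgryPge _).1 (@cvg_ln_nat R) 1)) => n n2 l1.
have l0 : 0 < ln n%:R :> R by exact: lt_le_trans l1.
have /andP[h1 h2] := @harmonic_sum_bounds R n (ltnW n2).
rewrite ler_pdivlMr// ler_pdivrMr// mul1r mulrDl mulVf ?gt_eqF// mul1r [_ + 1]addrC h2 andbT.
apply: le_trans h1; rewrite ler_ln ?posrE ?ltr0n ?ler_nat//; exact: ltnW.
Qed.

Lemma cvg_ln_succ_ratio (R : realType) :
  ln n.+1%:R / ln n%:R @[n --> \oo] --> (1 : R).
Proof.
apply: squeeze_cvgr (@cvg_1D_inv_ln R); last exact: cvg_cst.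
apply: (filterS2 _ _ (nbhs_infty_ge 2) ((cvgryPge _).1 (@cvg_ln_nat R) 1)) => n n2 l1.
have l0 : 0 < ln n%:R :> R by exact: lt_le_trans l1.
have /andP[h1 h2] := @harmonic_sum_bounds R n (ltnW n2).
rewrite ler_pdivlMr// ler_pdivrMr// mul1r mulrDl mulVf ?gt_eqF// mul1r [_ + 1]addrC (le_trans h1 h2) andbT.
rewrite ler_ln ?posrE ?ltr0n ?ler_nat//; exact: ltnW.
Qed.

(** The upper bound on S n is of order n ln n; the logarithm hides the second
    factor. *)
Lemma cvg_ln_sum_ratio (R : realType) (x : nat -> R) (c C : R) :
  let S n := \sum_(0 <= k < n) x k in
  0 < c -> (\forall n \near \oo, c * n%:R <= S n) ->
  0 < C -> (\forall n \near \oo, x n <= C * ln n%:R) ->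
  ln (S n) / ln n%:R @[n --> \oo] --> (1 : R).
Proof.
move=> S c0 lo C0 [N _ up].
have S_le n : (N <= n)%N -> (0 < n)%N -> S n <= (`|S N| + C * ln n%:R) * n%:R.
  move=> Nn n0; rewrite /S (@big_cat_nat _ _ _ N)//= mulrDl; apply: lerD.
    apply: le_trans (ler_norm _) _; rewrite ler_peMr//; first by rewrite ler1n.
  apply: (@le_trans _ _ (\sum_(N <= k < n) C * ln n%:R)).
    apply: ler_sum_nat => k /andP[Nk kn].
    apply: le_trans (up k Nk) _; rewrite ler_pM2l//.
    have [->|k0] := posnP k; first by rewrite ln0// ln_ge0// ler1n.
    by rewrite ler_ln ?posrE ?ltr0n// ler_nat ltnW.
  rewrite sumr_const_nat -[leLHS]mulr_natr ler_wpM2l ?ler_nat ?leq_subr//.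
  by rewrite mulr_ge0 ?ln_ge0 ?ler1n// ltW.
apply/cvgrPdistC_le => e e0.
pose A := `|S N| + C.
have A0 : 0 <= A by rewrite addr_ge0 ?normr_ge0// ltW.
(* With y = ln n, the middle term of M makes A y <= (e y)^2 / 2, which is at
   most exp (e y); the last one absorbs ln c into e y. *)
pose M := Num.max 1 (Num.max (2 * A / e ^+ 2) (`|ln c| / e)).
have hM : \forall n \near \oo, M <= ln (n%:R : R) by exact: (cvgryPge _).1 (@cvg_ln_nat R) M.
apply: (filterS3 _ _ lo (nbhs_infty_ge (maxn 1 N)) hM) => n loN nN.
rewrite !ge_max => /and3P[y1 y2 y3].
have [n1 Nn] : (1 <= n)%N /\ (N <= n)%N by lia.
have n0 : (0 : R) < n%:R by rewrite ltr0n.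
have y0 : 0 < ln n%:R :> R by exact: lt_le_trans y1.
have S0 : 0 < S n by apply: lt_le_trans loN; rewrite mulr_gt0.
rewrite ler_norml lerBlDr lerBrDr ler_pdivlMr// ler_pdivrMr//; apply/andP; split.
  have : ln (c * n%:R) <= ln (S n) by rewrite ler_ln ?posrE ?mulr_gt0.
  rewrite lnM ?posrE//.
  have := ler_norm (- ln c); rewrite normrN.
  by move: y3; rewrite ler_pdivrMr//; lra.
have h1 : S n <= expR (e * ln n%:R) * n%:R.
  apply: le_trans (S_le n Nn n1) _; rewrite ler_pM2r//.
  apply: (@le_trans _ _ (A * ln n%:R)).
    by rewrite /A mulrDl lerD2r ler_peMr.
  have ey0 : 0 <= e * ln n%:R by rewrite mulr_ge0// ltW.
  have := @expR_ge1Dxn R _ 1 ey0; rewrite /= => hE.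
  apply: le_trans hE; rewrite exprMn.
  move: y2; rewrite ler_pdivrMr ?exprn_gt0// => y2.
  have := ler_wpM2r (ltW y0) y2; rewrite (_ : 2`! = 2%N)//.
  by move: (ln n%:R) => y; rewrite !expr2; lra.
have h2 : ln (S n) <= ln (expR (e * ln n%:R) * n%:R).
  by rewrite ler_ln ?posrE ?mulr_gt0 ?expR_gt0.
apply: (le_trans h2); rewrite lnM ?posrE ?expR_gt0// expRK; lra.
Qed.

Section record_length_sum.
Variables (R : realType) (lambda : R) (r x : nat -> R).
Hypothesis lambda_gt0 : 0 < lambda.
Hypothesis r01 : forall n, r n = 0 \/ r n = 1.

Let K n := \sum_(0 <= k < n) r k.
Let V n := \sum_(0 <= k < n) r k * x k.

Hypothesis K_ln : K n / ln n%:R @[n --> \oo] --> (1 : R).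
Hypothesis x_le : forall e, 0 < e ->
  \forall n \near \oo, x n <= (1 + e) * ln n%:R / lambda.
Hypothesis x_ge : forall e, 0 < e < 1 ->
  \forall n \near \oo, r n = 1 -> (1 - e) * ln n%:R / lambda <= x n.

Let r_ge0 n : 0 <= r n. Proof. by case: (r01 n) => ->. Qed.

Let K_ge0 n : 0 <= K n. Proof. exact: sumr_ge0. Qed.

Let KS n : K n.+1 = K n + r n.
Proof. by rewrite /K big_nat_recr. Qed.

Let ndK : {homo K : i j / (i <= j)%N >-> i <= j}.
Proof.
apply: homo_leq => // [|n]; first exact: le_trans.
by rewrite KS lerDl.
Qed.

Let lnR : ln n%:R @[n --> \oo] --> (+oo : set_system R) := @cvg_ln_nat R.

Lemma cvg_count_pinfty : K @ \oo --> +oo.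
Proof.
apply/cvgryPge => A.
have h1 : \forall n \near \oo, `|1 - K n / ln n%:R| <= 1 / 2.
  by move/cvgrPdist_le : K_ln; apply; lra.
have h2 : \forall n \near \oo, Num.max 1 (2 * A) <= ln (n%:R : R).
  exact: (cvgryPge _).1 lnR _.
apply: (filterS2 _ _ h1 h2) => n; rewrite ge_max ler_norml => /andP[_ k1] /andP[l1 lA].
have l0 : 0 < ln (n%:R : R) by exact: lt_le_trans l1.
have : 1 / 2 <= K n / ln n%:R by lra.
by rewrite ler_pdivlMr//; lra.
Qed.

(** At a record both lambda * x n and the number of records so far are
    equivalent to ln n; at other times both sides vanish. *)
Lemma record_value_count (t : R) : 0 < t -> \forall n \near \oo,
  `|lambda * (r n * x n) - r n * K n.+1| <= t * (r n * K n.+1).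
Proof.
move=> t0.
pose e := Num.min (t / 4) (1 / 2).
have e0 : 0 < e by rewrite lt_min; apply/andP; split; lra.
have et : e <= t / 4 by rewrite ge_min lexx.
have e2 : e <= 1 / 2 by rewrite ge_min lexx orbT.
have e01 : 0 < e < 1 by rewrite e0; lra.
have KSln : K n.+1 / ln n%:R @[n --> \oo] --> (1 : R).
  have h : (K n.+1 / ln n.+1%:R) * (ln n.+1%:R / ln n%:R) @[n --> \oo] --> (1 : R).
    rewrite -[X in _ --> X](mulr1 1); apply: cvgM; last exact: cvg_ln_succ_ratio.
    by rewrite (cvg_shiftS (fun n => K n / ln n%:R)).
  apply: cvg_trans h; apply: near_eq_cvg.
  exists 1%N => // n /= n1; rewrite mulrA divfK// gt_eqF// ln_gt0//.
  by rewrite ltr1n ltnS.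
have hK : \forall n \near \oo, `|1 - K n.+1 / ln n%:R| <= e.
  by move/cvgrPdist_le : KSln; apply.
have hl : \forall n \near \oo, 1 <= ln (n%:R : R).
  exact: (cvgryPge _).1 lnR _.
have hx : \forall n \near \oo, x n <= (1 + e) * ln n%:R / lambda /\
    (r n = 1 -> (1 - e) * ln n%:R / lambda <= x n).
  apply: (filterS2 _ _ (x_le e0) (x_ge e01)) => n h1 h2; by split.
apply: (filterS3 _ _ hK hl hx) => n + l1 [xu xl].
have l0 : 0 < ln (n%:R : R) by exact: lt_le_trans l1.
have -> : 1 - K n.+1 / ln n%:R = (ln n%:R - K n.+1) / ln n%:R.
  by rewrite mulrBl divff// gt_eqF.
rewrite normrM normfV (gtr0_norm l0) ler_pdivrMr// ler_norml => /andP[k1 k2].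
have [->|r1] := r01 n; first by rewrite !mul0r mulr0 subrr normr0 mulr0.
rewrite r1 !mul1r.
move: (xl r1) xu; rewrite ler_pdivrMr// ler_pdivlMr// => {xl} xl xu.
move: (K n.+1) (ln n%:R) (x n * lambda) (mulrC lambda (x n)) l0 k1 k2 xl xu => k l y -> l0 k1 k2 xl xu.
(* l is ln n and k is the number of records: both k and lambda * x n are
   within e * l of l, and l <= 2 k. *)
have p1 : e * l <= t / 4 * l by rewrite ler_pM2r.
have kl : l / 2 <= k.
  have : e * l <= 1 / 2 * l by rewrite ler_pM2r.
  lra.
have p2 : t * (l / 2) <= t * k by rewrite ler_pM2l.
rewrite ler_norml; apply/andP; split; lra.
Qed.

(** As r n is 0 or 1, the increments of Q n := K n * (K n + 1) / 2 are
    r n * K n.+1, which are those of lambda * V n up to a factor tending to 1;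
    this is the sum of the first K n integers in disguise. *)
Lemma cvg_record_length_sum : V n / (ln n%:R) ^+ 2 @[n --> \oo] --> 1 / (2 * lambda).
Proof.
pose Q n := K n * (K n + 1) / 2.
have QS n : Q n.+1 - Q n = r n * K n.+1.
  by rewrite /Q KS; case: (r01 n) => ->; field.
have ndQ : {homo Q : i j / (i <= j)%N >-> i <= j}.
  apply: homo_leq => // [|n]; first exact: le_trans.
  by rewrite -subr_ge0 QS mulr_ge0.
have Qy : Q @ \oo --> +oo.
  apply/cvgryPge => A.
  have h : \forall n \near \oo, Num.max 1 A <= K n.
    exact: (cvgryPge _).1 cvg_count_pinfty _.
  apply: filterS h => n; rewrite ge_max => /andP[k1 kA].
  apply: (le_trans kA); rewrite /Q ler_pdivlMr// ler_wpM2l//; lra.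
have VQ : lambda * V n / Q n @[n --> \oo] --> (1 : R).
  apply: (@cvg_ratio_increments R (fun n => lambda * V n)) => // e e0.
  apply: filterS (record_value_count e0) => n.
  by rewrite QS -mulrBr {1}/V big_nat_recr//= addrAC -/(V n) subrr add0r.
have Kinv : (K n)^-1 @[n --> \oo] --> (0 : R).
  exact: cvg_inv_pinfty cvg_count_pinfty.
have lim : (lambda * V n / Q n) * ((K n / ln n%:R) * (K n / ln n%:R)) * (1 + (K n)^-1) / (2 * lambda)
    @[n --> \oo] --> (1 : R) * (1 * 1) * (1 + 0) / (2 * lambda).
  apply: cvgMl; apply: cvgM; first by apply: cvgM => //; exact: cvgM.
  by apply: cvgD => //; exact: cvg_cst.
rewrite !mulr1 addr0 mulr1 in lim.
apply: cvg_trans lim; apply: near_eq_cvg.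
have h1 : \forall n \near \oo, 1 <= K n by exact: (cvgryPge _).1 cvg_count_pinfty _.
have hl : \forall n \near \oo, 1 <= ln (n%:R : R) by exact: (cvgryPge _).1 lnR _.
apply: (filterS2 _ _ h1 hl) => n K1 l1.
rewrite /Q; field; rewrite !gt_eqF//; lra.
Qed.

End record_length_sum.

(** * Counting process and record time along one trajectory *)

Section path.
Context d (T : measurableType d) (R : realType) (P : probability T R).
Variables (X : nat -> {RV P >-> R}) (w : T).

Lemma recordE n : record X n w = \1_(record_event X n) w.
Proof.
rewrite /record indicE; have [/set_mem h|/negP h] := boolP (w \in record_event X n).
  by apply: big1 => k _; rewrite indicE mem_set//; exact: h.
apply/eqP/prodf_eq0 => /=.
have : ~ record_event X n w by move=> hn; apply: h; exact: mem_set.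
move=> /existsNP[k /not_implyP[kn xk]].
exists (Ordinal kn) => //=.
by rewrite indicE memNset.
Qed.

Lemma record01 n : record X n w = 0 \/ record X n w = 1.
Proof. by rewrite recordE indicE; case: (_ \in _); [right|left]. Qed.

Lemma count_recordsE n :
  count_events R (record_event X) n w = \sum_(0 <= k < n) record X k w.
Proof. by apply: eq_bigr => k _; rewrite recordE. Qed.

Lemma completed_recordsE t : (completed_records X t w)%:R =
  count_events R (record_event X) (poisson X t w) w.
Proof.
rewrite count_recordsE /completed_records big_mkord -sum1_card natr_sum.
rewrite big_mkcond/=; apply: eq_bigr => k _; rewrite inE.
by case: (record01 k) => ->; rewrite ?eqxx// eq_sym oner_eq0.
Qed.

Lemma arrivalE n : arrival X n w = \sum_(0 <= k < n) X k w.
Proof. by rewrite big_mkord. Qed.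

Lemma arrivalS n : arrival X n.+1 w = arrival X n w + X n w.
Proof. by rewrite !arrivalE big_nat_recr. Qed.

Lemma arrival0 : arrival X 0 w = 0.
Proof. by rewrite arrivalE big_nil. Qed.

Hypothesis X_gt0 : forall k, 0 < X k w.
Hypothesis arrival_pinfty : arrival X ^~ w @ \oo --> +oo.

Lemma le_arrival : {mono arrival X ^~ w : i j / (i <= j)%N >-> i <= j}.
Proof.
apply: le_mono; apply: homo_ltn => [|n]; first exact: lt_trans.
by rewrite arrivalS ltrDl.
Qed.

Lemma lt_arrival : {mono arrival X ^~ w : i j / (i < j)%N >-> i < j}.
Proof. exact: leW_mono le_arrival. Qed.

(** The supremum is attained because the arrival times increase strictly. *)
Lemma poisson_unique t N :
  arrival X N w <= t < arrival X N.+1 w -> poisson X t w = N.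
Proof.
move=> /andP[Nt tN]; rewrite /poisson.
set A := [set n | _].
have AN : A N by [].
have ubN : ubound A N.
  by move=> n An; rewrite leEnat -ltnS -lt_arrival (le_lt_trans An).
have supN : supremums A N by split => // m; apply.
rewrite /supremum; case: eqP => [A0|_]; first by move: AN; rewrite A0.
case: xgetP => [m mE [ubm lbm]|/(_ N)//].
by apply/eqP; rewrite eq_le ubm// lbm.
Qed.

Lemma poisson_arrival t : 0 <= t ->
  arrival X (poisson X t w) w <= t < arrival X (poisson X t w).+1 w.
Proof.
move=> t0.
have ex : exists n, t < arrival X n w.
  have [n _ /(_ n (leqnn n)) h] := (cvgryPge _).1 arrival_pinfty (t + 1).
  by exists n; apply: lt_le_trans h; rewrite ltrDl.
case: (ex_minnP ex) => -[|N]; first by rewrite arrival0 ltNge t0.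
move=> tN minN.
have h : arrival X N w <= t < arrival X N.+1 w.
  by rewrite tN andbT leNgt; apply/negP => /minN; rewrite ltnn.
by rewrite (poisson_unique h).
Qed.

(** The counting process equals k on [S k, S k.+1[, so the integrand is a step
    function; only the last step is cut, at t. *)
Lemma record_timeE t : 0 <= t -> let N := poisson X t w in
  record_time X t w = \sum_(0 <= k < N) record X k w * X k w
    + record X N w * (t - arrival X N w).
Proof.
move=> t0 N; have /andP[Nt tN] := poisson_arrival t0.
pose J k := `[arrival X k w, arrival X k.+1 w[%classic.
have rk0 k : 0 <= record X k w by case: (record01 k) => ->.
have step s : 0 <= s <= t -> record X (poisson X s w) w =
    \sum_(0 <= k < N.+1) record X k w * \1_(J k) s.
  move=> /andP[s0 st]; have /andP[ps sp] := poisson_arrival s0.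
  set M := poisson X s w in ps sp *.
  have MN : (M < N.+1)%N.
    by rewrite -lt_arrival (le_lt_trans ps)// (le_lt_trans st).
  rewrite (bigD1_seq M) ?iota_uniq ?mem_index_iota//=.
  rewrite [X in _ + X]big1 ?addr0.
    by rewrite indicE mem_set ?mulr1// /J /= in_itv/= ps.
  move=> k kM; rewrite indicE memNset ?mulr0// /J /= in_itv/= => h.
  by move: kM; rewrite -(poisson_unique h) eqxx.
have mJ k : lebesgue_measure (J k `&` `[0, t]%classic) =
    (if (k < N)%N then X k w else t - arrival X N w)%:E
    :> \bar R \/ (N < k)%N.
  have [Nk|kN|<-] := ltngtP N k; [by right| left..].
    have -> : J k `&` `[0, t]%classic = J k.
      apply/seteqP; split => s /=; first by case.
      rewrite /J/= !in_itv/= => /andP[ks sk]; rewrite ks sk; split => //.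
      rewrite (le_trans _ ks) -?arrival0 ?le_arrival//=.
      by rewrite (le_trans (ltW sk))// (le_trans _ Nt)// le_arrival.
    by rewrite /J lebesgue_measure_itv/= lte_fin arrivalS ltrDl X_gt0 -EFinD addrAC subrr add0r.
  have -> : J N `&` `[0, t]%classic = `[arrival X N w, t]%classic.
    apply/seteqP; split => s; rewrite /J/= !in_itv/=.
      by move=> [/andP[-> _] /andP[_ ->]].
    move=> /andP[Ns st]; rewrite Ns st (le_lt_trans st tN); split => //.
    by rewrite (le_trans _ Ns)// -arrival0 le_arrival.
  rewrite lebesgue_measure_itv/= lte_fin; case: ltP => // tN'.
  by congr (_%:E); apply/eqP; rewrite eq_sym subr_eq0 eq_le tN' Nt.
rewrite /record_time /Rintegral.
have -> : (\int[lebesgue_measure]_(s in `[0%R, t]) (record X (poisson X s w) w)%:E =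
  \int[lebesgue_measure]_(s in `[0%R, t]) \sum_(0 <= k < N.+1)
     ((record X k w)%:E * (\1_(J k) s)%:E))%E.
  apply: eq_integral => s; rewrite inE/= in_itv/= => /step ->.
  by rewrite -sumEFin.
rewrite ge0_integral_sum//; last 2 first.
- move=> k; apply: measurable_funeM; apply/measurable_EFinP.
  by apply: measurable_indic; exact: measurable_itv.
- by move=> k s _; rewrite -EFinM lee_fin indicE mulr_ge0 ?ler0n ?rk0.
rewrite (eq_big_nat _ _ (F2 := fun k => (record X k w * (if (k < N)%N then X k w else t - arrival X N w))%:E)).
  rewrite sumEFin/= big_nat_recr//= ltnn; congr (_ + _).
  by apply: eq_big_nat => k /= ->.
move=> k /= kN; rewrite ge0_integralZl//.
- rewrite integral_indic//; last exact: measurable_itv.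
  have [E|] := mJ k; last by rewrite ltnNge -ltnS kN.
  by apply: (eq_trans (congr1 (fun z => ((record X k w)%:E * z)%E) E)); rewrite -EFinM.
- by apply/measurable_EFinP; apply: measurable_indic; exact: measurable_itv.
- by rewrite lee_fin rk0.
Qed.

End path.

Section path_limits.
Context d (T : measurableType d) (R : realType) (P : probability T R).
Variables (lambda : R) (X : nat -> {RV P >-> R}) (w : T) (c : R).

Let S n := arrival X n w.
Let K n := count_events R (record_event X) n w.
Let V n := \sum_(0 <= k < n) record X k w * X k w.

Hypothesis lambda_gt0 : 0 < lambda.
Hypothesis X_gt0 : forall k, 0 < X k w.
Hypothesis K_harmonic :
  K n / (\sum_(0 <= k < n) k.+1%:R^-1) @[n --> \oo] --> (1 : R).
Hypothesis c_gt0 : 0 < c.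
Hypothesis S_ge : \forall n \near \oo, c * n%:R <= S n.
Hypothesis X_le : forall e, 0 < e ->
  \forall n \near \oo, X n w <= (1 + e) * ln n%:R / lambda.
Hypothesis X_ge : forall e, 0 < e < 1 -> \forall n \near \oo,
  exists2 k, (k < n)%N & (1 - e) * ln n%:R / lambda <= X k w.

Let lnR : ln n%:R @[n --> \oo] --> (+oo : set_system R) := @cvg_ln_nat R.

Let near_ln_ge1 : \forall n \near \oo, 1 <= ln (n%:R : R).
Proof. exact: (cvgryPge _).1 lnR _. Qed.

Lemma cvg_count_ln : K n / ln n%:R @[n --> \oo] --> (1 : R).
Proof.
have h : (K n / \sum_(0 <= k < n) k.+1%:R^-1) *
    ((\sum_(0 <= k < n) k.+1%:R^-1) / ln n%:R) @[n --> \oo] --> (1 : R).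
  by rewrite -[X in _ --> X](mulr1 1); apply: cvgM => //; exact: cvg_harmonic_ln.
apply: cvg_trans h; apply: near_eq_cvg.
exists 1%N => // n /= n1; rewrite /= mulrA divfK// gt_eqF//.
case: n n1 => // n _; rewrite big_nat_recl//= ltr_pwDl ?invr_gt0//.
by apply: sumr_ge0 => k _; rewrite invr_ge0.
Qed.

Lemma cvg_V_ln : V n / (ln n%:R) ^+ 2 @[n --> \oo] --> 1 / (2 * lambda).
Proof.
apply: (@cvg_record_length_sum R lambda (fun n => record X n w) (fun n => X n w)) => //.
- exact: record01.
- apply: cvg_trans cvg_count_ln; apply: near_eq_cvg.
  by apply: nearW => n; rewrite /K count_recordsE.
- move=> e e01; apply: filterS (X_ge e01) => n [k kn xk] rn.
  apply: (le_trans xk); apply: ltW.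
  move: rn; rewrite recordE indicE; have [/set_mem h _|_ /eqP] := boolP (w \in _).
    exact: h.
  by rewrite eq_sym oner_eq0.
Qed.

Lemma cvg_ln_arrival : ln (S n) / ln n%:R @[n --> \oo] --> (1 : R).
Proof.
have h : \forall n \near \oo, X n w <= (2 / lambda) * ln n%:R.
  apply: filterS (X_le (ltr01)) => n h; apply: le_trans h _.
  by rewrite mulrAC (_ : 1 + 1 = 2).
have := @cvg_ln_sum_ratio R (fun n => X n w) c (2 / lambda) c_gt0 _ _ h.
rewrite divr_gt0// => /(_ _ isT) H.
apply: cvg_trans (H _).
  by apply: near_eq_cvg; apply: nearW => n; rewrite /S arrivalE.
by apply: filterS S_ge => n; rewrite /S arrivalE.
Qed.

Lemma arrival_cvg_pinfty : S @ \oo --> +oo.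
Proof.
apply/cvgryPge => A.
apply: (filterS2 _ _ S_ge (nbhs_infty_ge (Num.truncn (A / c)).+1)) => n h1 h2.
apply: le_trans h1; rewrite mulrC -ler_pdivrMr//.
apply: le_trans (ltW (truncnS_gt _)) _.
by rewrite ler_nat.
Qed.

Let Sy := arrival_cvg_pinfty.

Lemma poisson_cvg_pinfty : poisson X t w @[t --> +oo] --> \oo.
Proof.
apply/cvgnyPge => A.
apply: filterS (nbhs_pinfty_ge (num_real (Num.max 0 (S A)))) => t.
rewrite ge_max => /andP[t0 At].
have /andP[_ tN] := poisson_arrival X_gt0 Sy t0.
rewrite -ltnS -(lt_arrival X_gt0).
exact: le_lt_trans tN.
Qed.

Let Ny := poisson_cvg_pinfty.

Let along_N (f : nat -> R) (l : R) : f n @[n --> \oo] --> l ->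
  f (poisson X t w) @[t --> +oo] --> l.
Proof. by move=> fl; exact: (cvg_comp (poisson X ^~ w) f Ny fl). Qed.

Let near_N (Q : nat -> Prop) : (\forall n \near \oo, Q n) ->
  \forall t \near +oo, Q (poisson X t w).
Proof. by move=> h; exact: Ny h. Qed.

Let near_t0 : \forall t \near +oo, (0 : R) <= t.
Proof. exact: nbhs_pinfty_ge (num_real 0). Qed.

(** From S N <= t < S N.+1, where ln (S n) and ln (S n.+1) are equivalent to
    ln n. *)
Lemma cvg_ln_poisson : ln (poisson X t w)%:R / ln t @[t --> +oo] --> (1 : R).
Proof.
have lnt : ln t / ln (poisson X t w)%:R @[t --> +oo] --> (1 : R).
  have u := along_N cvg_ln_arrival.
  have v : ln (S (poisson X t w).+1) / ln (poisson X t w)%:R @[t --> +oo] --> (1 : R).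
    apply: (along_N (f := fun n => ln (S n.+1) / ln n%:R)).
    have h : (ln (S n.+1) / ln n.+1%:R) * (ln n.+1%:R / ln n%:R) @[n --> \oo] --> (1 : R).
      rewrite -[X in _ --> X](mulr1 1); apply: cvgM; last exact: cvg_ln_succ_ratio.
      by rewrite (cvg_shiftS (fun n => ln (S n) / ln n%:R)); exact: cvg_ln_arrival.
    apply: cvg_trans h; apply: near_eq_cvg.
    exists 1%N => // n /= n1; rewrite mulrA divfK// gt_eqF// ln_gt0//.
    by rewrite ltr1n ltnS.
  apply: squeeze_cvgr u v.
  apply: (filterS3 _ _ near_t0 (near_N near_ln_ge1) (near_N (nbhs_infty_ge 1))) => t t0 l1 N1.
  have l0 : 0 < ln (poisson X t w)%:R :> R by exact: lt_le_trans l1.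
  have /andP[Nt tN] := poisson_arrival X_gt0 Sy t0.
  have SN0 : 0 < S (poisson X t w).
    by rewrite /S -(arrival0 X w) (lt_arrival X_gt0).
  have t_gt0 : 0 < t by exact: lt_le_trans Nt.
  by rewrite !ler_pM2r ?invr_gt0// !ler_ln ?posrE ?(lt_trans t_gt0 tN)// Nt ltW.
have h : (ln t / ln (poisson X t w)%:R)^-1 @[t --> +oo] --> (1 : R).
  by rewrite -[X in _ --> X]invr1; apply: cvgV => //; exact: oner_neq0.
apply: cvg_trans h; apply: near_eq_cvg; apply: nearW => t /=.
by rewrite invfM invrK mulrC.
Qed.

Lemma cvg_completed_records :
  (completed_records X t w)%:R / ln t @[t --> +oo] --> (1 : R).
Proof.
have h : (K (poisson X t w) / ln (poisson X t w)%:R) * (ln (poisson X t w)%:R / ln t)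
    @[t --> +oo] --> (1 : R).
  rewrite -[X in _ --> X](mulr1 1); apply: cvgM; last exact: cvg_ln_poisson.
  exact: along_N cvg_count_ln.
apply: cvg_trans h; apply: near_eq_cvg.
apply: filterS (near_N near_ln_ge1) => t l1 /=.
rewrite mulrA divfK ?completed_recordsE// gt_eqF//.
exact: lt_le_trans l1.
Qed.

(** The record time lies between the record lengths accumulated over N and over
    N.+1 inter-arrival times. *)
Lemma cvg_record_time :
  record_time X t w / (ln t) ^+ 2 @[t --> +oo] --> 1 / (2 * lambda).
Proof.
have W : record_time X t w / (ln (poisson X t w)%:R) ^+ 2 @[t --> +oo] --> 1 / (2 * lambda).
  have u := along_N cvg_V_ln.
  have v : V (poisson X t w).+1 / (ln (poisson X t w)%:R) ^+ 2 @[t --> +oo] --> 1 / (2 * lambda).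
    apply: (along_N (f := fun n => V n.+1 / (ln n%:R) ^+ 2)).
    have h : (V n.+1 / (ln n.+1%:R) ^+ 2) * ((ln n.+1%:R / ln n%:R) * (ln n.+1%:R / ln n%:R))
        @[n --> \oo] --> 1 / (2 * lambda) * (1 * 1).
      apply: cvgM; last by apply: cvgM; exact: cvg_ln_succ_ratio.
      by rewrite (cvg_shiftS (fun n => V n / (ln n%:R) ^+ 2)); exact: cvg_V_ln.
    rewrite !mulr1 in h; apply: cvg_trans h; apply: near_eq_cvg.
    apply: (filterS2 _ _ (nbhs_infty_ge 1) near_ln_ge1) => n /= n1 l1.
    have : 0 < ln n%:R :> R by exact: lt_le_trans l1.
    have : 0 < ln n.+1%:R :> R by rewrite ln_gt0// ltr1n ltnS.
    by move: (ln _) (ln _) => a b a0 b0; field; rewrite !gt_eqF.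
  apply: squeeze_cvgr u v.
  apply: (filterS2 _ _ near_t0 (near_N near_ln_ge1)) => t t0 l1.
  have l0 : 0 < ln (poisson X t w)%:R :> R by exact: lt_le_trans l1.
  have /andP[Nt tN] := poisson_arrival X_gt0 Sy t0.
  have r0 : 0 <= record X (poisson X t w) w by case: (record01 X w (poisson X t w)) => ->.
  rewrite !ler_pM2r ?invr_gt0 ?exprn_gt0// record_timeE// {2}/V big_nat_recr//= -/(V _).
  rewrite lerDl mulr_ge0 ?subr_ge0//= lerD2l ler_wpM2l//.
  by rewrite lerBlDl -arrivalS ltW.
have h : (record_time X t w / (ln (poisson X t w)%:R) ^+ 2) *
    ((ln (poisson X t w)%:R / ln t) * (ln (poisson X t w)%:R / ln t))
    @[t --> +oo] --> 1 / (2 * lambda) * (1 * 1).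
  by apply: cvgM => //; apply: cvgM; exact: cvg_ln_poisson.
rewrite !mulr1 in h; apply: cvg_trans h; apply: near_eq_cvg.
apply: (filterS2 _ _ (near_N near_ln_ge1) (nbhs_pinfty_gt (num_real (1 : R)))) => t l1 t1 /=.
have : 0 < ln (poisson X t w)%:R :> R by exact: lt_le_trans l1.
have : 0 < ln t by rewrite ln_gt0.
by move: (ln _) (ln _) => a b a0 b0; field; rewrite !gt_eqF.
Qed.

End path_limits.

(** * Almost sure behaviour of the inter-arrival times *)

Section almost_sure.
Context d (T : measurableType d) (R : realType) (P : probability T R).
Variables (lambda : R) (X : nat -> {RV P >-> R}).
Hypothesis lambda_gt0 : 0 < lambda.
Hypothesis X_indep : independent_RVs X.
Hypothesis X_exp : forall k, exponentially_distributed lambda (X k).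

Lemma ae_exp_gt0 : {ae P, forall w, forall k, 0 < X k w}.
Proof.
apply: ae_foralln => k; exists [set w | X k w <= 0]; split.
- exact: measurable_RV_le.
- by have := prob_exp_le X_exp k (lexx 0); rewrite mulr0 expR0 subrr.
- by move=> w /= /negP; rewrite -leNgt.
Qed.

Lemma prob_setI_preimage j k (A : set R) : j != k -> measurable A ->
  P (X j @^-1` A `&` X k @^-1` A) = (P (X j @^-1` A) * P (X k @^-1` A))%E.
Proof.
move=> jk mA.
have := @X_indep [fset j; k]%fset (fun=> A) (fun _ _ => mA).
rewrite big_fsetU1 ?inE//= big_seq_fset1 => <-; congr (P _).
apply/seteqP; split => w /=.
  by move=> [wj wk] i /=; rewrite !inE => /orP[] /eqP ->.
by move=> h; split; apply: h; rewrite /= !inE eqxx ?orbT.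
Qed.

(** The arrival time is at least the number of inter-arrival times that exceed
    1, which is equivalent to n * expR (- lambda). *)
Lemma ae_arrival_ge_linear : {ae P, forall w,
  \forall n \near \oo, expR (- lambda) / 2 * n%:R <= arrival X n w}.
Proof.
pose p := expR (- lambda); have p0 : 0 < p by exact: expR_gt0.
pose A k := X k @^-1` `]1, +oo[%classic.
have mA k : measurable (A k) by exact: measurable_RV_preimage.
have PA k : P (A k) = p%:E.
  rewrite (_ : A k = [set w | 1 < X k w]).
    by rewrite (prob_exp_gt X_exp)// mulr1.
  by apply/seteqP; split => w; rewrite /A /= in_itv/= andbT.
have PAA j k : (j < k)%N -> P (A j `&` A k) = (p * p)%:E.
  by move=> jk; rewrite prob_setI_preimage ?ltn_eqF// !PA.
have sE n : \sum_(0 <= k < n) p = n%:R * p by rewrite sumr_const_nat subn0 mulr_natl.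
have sy : \sum_(0 <= k < n) p @[n --> \oo] --> +oo.
  apply/cvgryPge => B; apply: filterS (nbhs_infty_ge (Num.truncn (B / p)).+1) => n Bn.
  rewrite sE -ler_pdivrMr//; apply: le_trans (ltW (truncnS_gt _)) _.
  by rewrite ler_nat.
have h := strong_law_pairwise_independent_events mA PA PAA sy.
apply: (filterS2 _ _ h ae_exp_gt0) => w /cvgrPdist_le Hw w0.
have h2 : (0 : R) < 1 / 2 by lra.
apply: (filterS2 _ _ (Hw _ h2) (nbhs_infty_ge 1)) => n + n1.
have n0 : 0 < n%:R * p by rewrite mulr_gt0// ltr0n.
rewrite sE ler_norml => /andP[_ hn].
have : 1 / 2 <= count_events R A n w / (n%:R * p) by lra.
rewrite ler_pdivlMr// => hc; apply: (@le_trans _ _ (count_events R A n w)).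
  by apply: le_trans hc; rewrite -/p; lra.
rewrite arrivalE; apply: ler_sum => k _; rewrite indicE.
have [/set_mem|_] := boolP (w \in A k); last exact: ltW.
by rewrite /A /= in_itv/= andbT => /ltW.
Qed.

(** Strong law for the record events of the uniformized variables. *)
Lemma ae_count_records_harmonic : {ae P, forall w,
  count_events R (record_event X) n w / (\sum_(0 <= k < n) k.+1%:R^-1)
    @[n --> \oo] --> (1 : R)}.
Proof.
have Ui := uniformized_indep lambda X_indep.
have Uu := uniformized_unif lambda_gt0 X_exp.
apply: (@strong_law_pairwise_independent_events _ _ _ P (record_event X) (fun k => k.+1%:R^-1)).
- by move=> k; rewrite (record_event_uniformized X lambda_gt0); exact: measurable_record_event.
- by move=> k; rewrite (record_event_uniformized X lambda_gt0); exact: prob_record_event.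
- move=> j k jk; rewrite !(record_event_uniformized X lambda_gt0).
  exact: record_events_pairwise_independent.
- apply/cvgryPge => A.
  have hA : \forall n \near \oo, A <= ln (n%:R : R).
    exact: (cvgryPge _).1 (@cvg_ln_nat R) _.
  apply: (filterS2 _ _ hA (nbhs_infty_ge 1)) => n An n1.
  have /andP[h _] := @harmonic_sum_bounds R n n1.
  apply: le_trans h; apply: (le_trans An).
  by rewrite ler_ln ?posrE ?ltr0n// ler_nat.
Qed.

(** A countable family of values of e suffices, by monotonicity; this puts the
    quantifier over e inside the almost sure statement. *)
Lemma ae_exp_le_ln : {ae P, forall w, forall e, 0 < e ->
  \forall n \near \oo, X n w <= (1 + e) * ln n%:R / lambda}.
Proof.
have H : {ae P, forall w, forall i : nat,
    \forall n \near \oo, X n w <= (1 + i.+2%:R^-1) * ln n%:R / lambda}.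
  by apply: ae_foralln => i; apply: ae_eventually_exp_le.
apply: filterS H => w Hw e e0; have [i ie] := exists_invn_le e0.
apply: (filterS2 _ _ (Hw i) (nbhs_infty_ge 1)) => n hn n1.
apply: (le_trans hn); rewrite ler_pM2r ?invr_gt0// ler_wpM2r ?lerD2l//.
by rewrite ln_ge0// ler1n.
Qed.

Lemma ae_exists_exp_ge_ln : {ae P, forall w, forall e, 0 < e < 1 ->
  \forall n \near \oo,
    exists2 k, (k < n)%N & (1 - e) * ln n%:R / lambda <= X k w}.
Proof.
have H : {ae P, forall w, forall i : nat, \forall n \near \oo,
    exists2 k, (k < n)%N & (1 - i.+2%:R^-1) * ln n%:R / lambda <= X k w}.
  apply: ae_foralln => i; apply: ae_eventually_exists_exp_gt => //.
  by rewrite invr_gt0 ltr0n invf_lt1// ltr1n.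
apply: filterS H => w Hw e /andP[e0 _]; have [i ie] := exists_invn_le e0.
apply: (filterS2 _ _ (Hw i) (nbhs_infty_ge 1)) => n [k kn hk] n1.
exists k => //; apply: le_trans hk.
rewrite ler_pM2r ?invr_gt0// ler_wpM2r ?lerB//.
by rewrite ln_ge0// ler1n.
Qed.

End almost_sure.

Theorem theorem1p1 (d : measure_display) (T : measurableType d) (R : realType)
    (P : probability T R) (lambda : R) (X : nat -> {RV P >-> R})
    (lambda_gt0 : 0 < lambda)
    (X_indep : independent_RVs X)
    (X_exp : forall k, exponentially_distributed lambda (X k)) :
  {ae P, forall w,
     ((completed_records X t w)%:R / ln t @[t --> +oo] --> (1 : R)) /\
     (record_time X t w / (ln t) ^+ 2 @[t --> +oo] --> 1 / (2 * lambda))}.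
Proof.
have c_gt0 : 0 < expR (- lambda) / 2 by rewrite divr_gt0 ?expR_gt0.
have h1 := ae_exp_gt0 X_exp.
have h2 := ae_arrival_ge_linear X_indep X_exp.
have h3 := ae_count_records_harmonic lambda_gt0 X_indep X_exp.
have h4 := ae_exp_le_ln lambda_gt0 X_exp.
have h5 := ae_exists_exp_ge_ln lambda_gt0 X_indep X_exp.
apply: (filterS2 _ _ (filterI h1 (filterI h2 h3)) (filterI h4 h5)).
move=> w [X_gt0 [S_ge K_cvg]] [X_le X_ge]; split.
  exact: (cvg_completed_records lambda_gt0 X_gt0 K_cvg c_gt0 S_ge X_le).
exact: (cvg_record_time lambda_gt0 X_gt0 K_cvg c_gt0 S_ge X_le X_ge).
Qed.
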